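(* Let $\lambda>0$ and $q\in(1,\infty)$. Then the spaces $h^{1,q}(\mathbb{R}_\lambda)$ and $h^{1,\infty}(\mathbb{R}_\lambda)$ coincide, with equivalent norms.
   Context: Fix $\lambda>0$. $\mathbb{R}_+=(0,\infty)$, $dm_\lambda(x)=x^{2\lambda}\,dx$, $d\mu_\lambda(x_1,x_2)=dm_\lambda(x_1)\,dm_\lambda(x_2)$, and $\mathbb{R}_\lambda=(\mathbb{R}_+\times\mathbb{R}_+,d\mu_\lambda)$. A rectangle is a product $R=I\times J$ of bounded intervals in $\mathbb{R}_+$. For $q\in(1,\infty]$, a $q$-atom on $\mathbb{R}_\lambda$ is a function $a\in L^q(\mathbb{R}_\lambda)$ supported on a rectangle $R\subset\mathbb{R}_+\times\mathbb{R}_+$ with $\|a\|_{L^q(\mathbb{R}_\lambda)}\le\mu_\lambda(R)^{\frac1q-1}$ and $\int_{\mathbb{R}_+\times\mathbb{R}_+}a\,d\mu_\lambda=0$. The space $h^{1,q}(\mathbb{R}_\lambda)$ is the set of functions of the form $f=\sum_i\alpha_ia_i$ (convergence in $L^1(\mathbb{R}_\lambda)$) with $a_i$ $q$-atoms, $\alpha_i\in\mathbb{C}$, $\sum_i|\alpha_i|<\infty$, with norm $\|f\|_{h^{1,q}(\mathbb{R}_\lambda)}=\inf\sum_i|\alpha_i|$, the infimum over all such decompositions of $f$. *)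

(* Defs.v *)
From HB Require Import structures.
From mathcomp Require Import all_boot all_order all_algebra.
From mathcomp Require Import complex.
From mathcomp Require Import all_classical all_reals all_analysis.
From mathcomp Require Import measurable_realfun.

Set Implicit Arguments.
Unset Strict Implicit.
Unset Printing Implicit Defensive.
Import Order.TTheory GRing.Theory Num.Theory.
Import numFieldNormedType.Exports.
Local Open Scope classical_set_scope.
Local Open Scope ring_scope.

Section bessel_measure.
Context {R : realType}.
Implicit Types (lam : R) (A : set (measurableTypeR R)).
Local Open Scope ereal_scope.

(* The half-line (0, oo) is not a type of its own here: [mlam lam] is carried
   by the whole line and gives no mass to the complement of (0, oo). *)
Definition mlam lam A : \bar R :=
  \int[lebesgue_measure]_(x in A `&` `]0%R, +oo[) (x `^ (2 * lam))%:E.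

Let mdens lam (D : set (measurableTypeR R)) :
  measurable_fun D (fun x : R => (x `^ (2 * lam))%:E).
Proof.
by apply/measurable_EFinP; apply: measurable_funTS; exact: measurable_powR.
Qed.

Let mlam0 lam : mlam lam set0 = 0.
Proof. by rewrite /mlam set0I integral_set0. Qed.

Let mlam_ge0 lam A : 0 <= mlam lam A.
Proof. by apply: integral_ge0 => x _; rewrite lee_fin powR_ge0. Qed.

Let mlam_semi_sigma_additive lam : semi_sigma_additive (mlam lam).
Proof.
move=> /= F mF tF mUF; rewrite /mlam setI_bigcupl; apply: cvg_toP.
  apply: ereal_nondecreasing_is_cvgn => m n mn.
  by apply: lee_sum_nneg_natr => // k _ _; exact: mlam_ge0.
rewrite ge0_integral_bigcup//=.
- by move=> k; exact: measurableI.
- by move=> x _; rewrite lee_fin powR_ge0.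
- exact: trivIset_setIr.
Qed.

HB.instance Definition _ lam := isMeasure.Build _ _ _ (mlam lam)
  (mlam0 lam) (@mlam_ge0 lam) (@mlam_semi_sigma_additive lam).

Let mlam_sigma_finite lam : sigma_finite setT (mlam lam).
Proof.
pose F (n : nat) : set (measurableTypeR R) :=
  `[(- n%:R)%R, n%:R%R]%classic `&`
  (fun x : R => (x `^ (2 * lam))%R) @^-1` `]-oo, n%:R%R]%classic.
have mF n : measurable (F n).
  apply: measurableI => //.
  by rewrite -[X in measurable X]setTI; apply: measurable_powR.
exists F => [|n].
  apply/seteqP; split => // x _.
  exists (Num.truncn (`|x| + x `^ (2 * lam))%R).+1 => //.
  have := truncnS_gt (`|x| + x `^ (2 * lam))%R => /ltW h.
  split; rewrite /= in_itv/=.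
    rewrite -ler_norml; apply: le_trans h; by rewrite lerDl powR_ge0.
  by apply: le_trans h; rewrite lerDr normr_ge0.
split => //.
have mFp : measurable (F n `&` `]0%R, +oo[) by exact: measurableI.
apply: (@le_lt_trans _ _
  (\int[lebesgue_measure]_(x in F n `&` `]0%R, +oo[) n%:R%:E)).
  apply: ge0_le_integral => //.
  - by move=> x _; rewrite lee_fin powR_ge0.
  - by move=> x [[_]]; rewrite /preimage/= in_itv/= => xn _; rewrite lee_fin.
rewrite (integral_cst _ mFp)/=; apply: lte_mul_pinfty => //.
apply: (@le_lt_trans _ _ (lebesgue_measure `[(- n%:R)%R : R, n%:R%R]%classic)).
  by apply: le_measure; rewrite ?inE//; move=> x [[]].
by rewrite lebesgue_measure_itv/=; case: ifPn => // _; rewrite -EFinB ltry.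
Qed.

HB.instance Definition _ lam := Measure_isSigmaFinite.Build _ _ _ (mlam lam)
  (mlam_sigma_finite lam).

End bessel_measure.

Definition mulam {R : realType} (lam : R) :
    {measure set (measurableTypeR R * measurableTypeR R) -> \bar R} :=
  (mlam lam \x mlam lam)%E.

Section atomic_hardy.
Context {R : realType}.
(* A function on (0, oo) x (0, oo) is represented by any measurable extension
   to the plane; the values off the quadrant are not seen by [mulam lam]. *)
Local Notation fct := (R * R -> R[i]).
Implicit Types (lam : R) (q : \bar R) (f a : fct).

Definition measurableC f : Prop :=
  measurable_fun [set: R * R] (fun x => complex.Re (f x)) /\
  measurable_fun [set: R * R] (fun x => complex.Im (f x)).

Definition LnormC lam q f : \bar R :=
  Lnorm (mulam lam) q (fun x => (Normc.normc (f x))%:E).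

Definition integralC lam f : R[i] :=
  ((Rintegral (mulam lam) setT (fun x => complex.Re (f x))) +i*
   (Rintegral (mulam lam) setT (fun x => complex.Im (f x))))%C.

Definition rectangle (A : set (R * R)) : Prop :=
  exists I J : set R,
    [/\ is_interval I /\ bounded_set I, I `<=` `]0, +oo[,
        is_interval J /\ bounded_set J, J `<=` `]0, +oo[
      & A = I `*` J].

(* In the size condition 1/q is 0 for q = +oo.  For a rectangle of measure 0
   the right-hand side is 0, since [0 `^ r] is 0 for r <> 0; as a function
   supported there is null anyway, such rectangles only yield the zero atom. *)
Definition is_atom lam q a : Prop :=
  measurableC a /\
  exists A : set (R * R),
    [/\ rectangle A,
        forall x, ~ A x -> a x = 0,
        (LnormC lam q a <= poweR (mulam lam A) (fine (inve q) - 1))%E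
      & integralC lam a = 0].

Definition l1sum (alpha : nat -> R[i]) : \bar R :=
  (\sum_(0 <= i <oo) (Normc.normc (alpha i))%:E)%E.

(* Finite combinations are covered by taking [alpha] eventually zero. *)
Definition atomic_decomposition lam q f
    (alpha : nat -> R[i]) (a : nat -> fct) : Prop :=
  [/\ forall i, is_atom lam q (a i),
      (l1sum alpha < +oo)%E
    & LnormC lam 1%E (fun x => f x - \sum_(i < n) alpha i * a i x)
        @[n --> \oo] --> 0%E].

(* Closed under equality [mulam lam]-almost everywhere among measurable
   functions, so that equality of these sets is equality of the corresponding
   spaces of classes. *)
Definition h1 lam q : set fct :=
  [set f | measurableC f /\
           exists (alpha : nat -> R[i]) (a : nat -> fct),
             atomic_decomposition lam q f alpha a].

Definition h1norm lam q f : \bar R :=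
  ereal_inf [set s | exists (alpha : nat -> R[i]) (a : nat -> fct),
    atomic_decomposition lam q f alpha a /\ s = l1sum alpha].

End atomic_hardy.

(* Main.v *)
Require Import Defs.
From mathcomp Require Import all_boot all_order all_algebra.
From mathcomp Require Import complex.
From mathcomp Require Import all_classical all_reals all_analysis.
From mathcomp Require Import measurable_realfun ess_sup_inf.
From mathcomp Require Import ring lra.

(* Only h^{1,q} in h^{1,oo} needs work: it suffices to write a q-atom [a] on a
   rectangle A, up to null sets, as a bounded combination of oo-atoms plus a
   finite combination of q-atoms with coefficients summing to at most 1/2, and
   to iterate.  This is a Calderon-Zygmund decomposition at a height t/mu(A).
   No dyadic grid and no differentiation theorem are used.  First, [a] is
   approximated in L^q by a function [s] that is constant on the cells of a
   finite grid.  Then A is cut along the finitely many grid lines one at a time.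
   If a cut produces a side on which the mean of |a|^q exceeds (t/mu(A))^q, the
   side is enlarged, as in the rising sun lemma, until the mean equals that
   value, and it is set aside; the mean over the remainder stays below it.  The
   tiles so obtained either carry exactly the critical mean, and then have small
   total measure, or lie in a single cell of the grid, where [a] is close to a
   constant.  Subtracting from [a] its mean over each tile yields the new
   q-atoms; the means themselves add up to a bounded function on A. *)

Set Implicit Arguments.
Unset Strict Implicit.
Unset Printing Implicit Defensive.
Import Order.TTheory GRing.Theory Num.Theory.
Import numFieldNormedType.Exports.
Local Open Scope classical_set_scope.
Local Open Scope ring_scope.

(** * Tilings by successive cuts, and the rising sun selection *)

Section tilings.
Context {R : realType}.
Local Notation T := (measurableTypeR R * measurableTypeR R)%type.
Implicit Types (A B Q P : set T) (c : bool * R) (L : seq (set T)).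

(** Growing a selected side to exact equality serves two ends: the mean of |a|^q over every tile is
    at most the q-th power of the height, which bounds the mean of [a] there, and the equality turns
    the measure of the critical tiles into an integral of |a|^q. Each of them costs a weight of
    order height times measure, so that together they cost a multiple of t^(1-q); as q > 1, this is
    small for large t. On a tile inside one cell of the grid the deviation of [a] from the constant
    value of [s] is compared with a small number e: either its q-mean is at most e^q and the tile
    costs at most 8 e times its measure, or the tile is paid for by the L^q distance from [a] to
    [s], which is chosen after t and e. Means are estimated through y <= 1 + y^q instead of
    Hoelder's inequality, whence the factors 2 and 8. Real and imaginary parts are treated
    separately, which doubles the weights. Within one step all families are finite lists; limits
    occur only in the iteration, where one atom of the given series enters at each stage. *)

Definition coord (b : bool) (x : T) : R := if b then x.1 else x.2.

Definition halfplane c : set T := [set x | coord c.1 x <= c.2].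

(** The tree of cuts is kept, rather than a bare partition, so that additivity of integrals and
    every property stable under one cut pass to the tiles by induction. The list may contain empty
    tiles. *)
Inductive tiles : set T -> seq (set T) -> Prop :=
| tile1 A : tiles A [:: A]
| tile_cut c A L1 L2 :
    tiles (A `&` halfplane c) L1 -> tiles (A `&` ~` halfplane c) L2 ->
    tiles A (L1 ++ L2).

Lemma tiles_hereditary (p : set T -> Prop) A L :
  (forall A c, p A -> p (A `&` halfplane c) /\ p (A `&` ~` halfplane c)) ->
  tiles A L -> p A -> forall B, B \in L -> p B.
Proof.
move=> pcut; elim=> [{}A pA B|c {}A L1 L2 _ IH1 _ IH2 pA B].
  by rewrite inE => /eqP ->.
have [p1 p2] := pcut A c pA.
by rewrite mem_cat => /orP[/IH1|/IH2]; apply.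
Qed.

Lemma tiles_subset A L : tiles A L -> forall B, B \in L -> B `<=` A.
Proof.
move=> tAL; apply: (tiles_hereditary _ tAL) => // B c BA.
by split=> x [/BA].
Qed.

Lemma tiles_indic A L x : tiles A L -> \1_A x = \sum_(B <- L) \1_B x :> R.
Proof.
elim=> [{}A|c {}A L1 L2 _ IH1 _ IH2]; first by rewrite big_seq1.
rewrite big_cat/= -IH1 -IH2 !indicE !in_setI in_setC.
by case: (x \in A); case: (x \in halfplane c); rewrite /= ?addr0 ?add0r.
Qed.

Lemma measurable_coord b : measurable_fun setT (coord b).
Proof. by case: b; [exact: measurable_fst|exact: measurable_snd]. Qed.

Lemma measurable_halfplane c : measurable (halfplane c).
Proof.
rewrite -[X in measurable X]setTI.
rewrite (_ : halfplane c = coord c.1 @^-1` `]-oo, c.2]%classic); last first.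
  by apply/seteqP; split=> x; rewrite /= in_itv.
exact: measurable_coord.
Qed.

Definition uncrossed c P := P `<=` halfplane c \/ P `<=` ~` halfplane c.

Definition bounded_coords Q := exists M : R, forall x b, Q x -> `|coord b x| <= M.

Variable mu : {measure set T -> \bar R}.
Hypothesis mu_line : forall b s, mu [set x | coord b x = s] = 0%E.

(** Since lines are null, the truncations of [h] converge almost everywhere when the cutting line
    moves: at a point off the limiting line they are eventually constant. Dominated convergence with
    bound |h| concludes. This continuity is what allows a side to be grown until its integral takes
    a prescribed value. *)
Lemma continuous_Rintegral_halfplane Q b (h : T -> R) :
  measurable Q -> mu.-integrable Q (EFin \o h) ->
  continuous (fun s : R => \int[mu]_(x in Q `&` halfplane (b, s)) h x : R).
Proof.
move=> mQ ih s; apply/(@cvg_nbhsP _ R^o) => u us.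
have {}us : u n @[n --> \oo] --> s := us.
pose f_ r x := (EFin \o h \_ (halfplane (b, r))) x.
have mf_ r : measurable_fun Q (f_ r).
  apply/measurable_EFinP; apply/measurable_restrict => //.
    exact: measurable_halfplane.
  apply: (@measurable_funS _ _ _ _ Q) => //.
  by apply/measurable_EFinP; exact: measurable_int ih.
have line_meas : measurable [set x : T | coord b x = s].
  rewrite -[X in measurable X]setTI.
  rewrite (_ : [set x | _] = coord b @^-1` [set s]); last by [].
  exact: measurable_coord.
have [|||[ifs _ /= cvgf]] := @dominated_convergence _ T R mu Q mQ
    (fun n => f_ (u n)) (f_ s) (fun x => `|(h x)%:E|)%E
    (fun n => mf_ (u n)) (mf_ s).
  - exists [set x | coord b x = s]; split => // x /= /not_implyP[Qx].
    apply: contra_notP => /eqP; rewrite neq_lt => /orP[xs|sx].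
      apply: cvg_near_cst.
      have : \forall n \near \oo, coord b x < u n by exact: (cvgr_gt s us).
      apply: filterS => n xn.
      rewrite /f_ /= /restrict /= !mem_set //; first exact: ltW.
      by rewrite /halfplane /= ltW.
    apply: cvg_near_cst.
    have : \forall n \near \oo, u n < coord b x by exact: (cvgr_lt s us).
    apply: filterS => n xn.
    rewrite /f_ /= /restrict /= !memNset //; rewrite /halfplane /=;
      apply/negP; by rewrite -ltNge.
  - exact: integrable_abse.
  - apply: nearW => x n Qx; rewrite /f_ /= /restrict; case: ifP => //= _.
    by rewrite normr0 lee_fin.
rewrite /= Rintegral_mkcondr.
under eq_fun do rewrite Rintegral_mkcondr.
rewrite /Rintegral; apply: (@fine_cvg _ _ _ _ (fun n => \int[mu]_(x in Q) f_ (u n) x)%E).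
by rewrite fineK //; exact: integrable_fin_num.
Qed.

Lemma Rintegral_cut Q c (h : T -> R) :
  measurable Q -> mu.-integrable Q (EFin \o h) ->
  \int[mu]_(x in Q) h x = \int[mu]_(x in Q `&` halfplane c) h x +
                          \int[mu]_(x in Q `&` ~` halfplane c) h x.
Proof.
move=> mQ ih; have mc := measurable_halfplane c; have mc' := measurableC mc.
have QE : Q `&` halfplane c `|` Q `&` ~` halfplane c = Q.
  by rewrite -setIUr setUv setIT.
rewrite -Rintegral_setU ?QE//; try exact: measurableI.
by apply/disj_setPS => x [[_ xc] [_ nxc]]; exact: nxc.
Qed.

Lemma Rintegral_tiles Q L (h : T -> R) :
  tiles Q L -> measurable Q -> mu.-integrable Q (EFin \o h) ->
  \int[mu]_(x in Q) h x = \sum_(P <- L) \int[mu]_(x in P) h x.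
Proof.
elim=> [A mA iA|c A L1 L2 _ IH1 _ IH2 mA iA]; first by rewrite big_seq1.
have mc := measurable_halfplane c; have mc' := measurableC mc.
rewrite big_cat /= (Rintegral_cut c mA iA) IH1 ?IH2//; try exact: measurableI.
all: apply: (integrableS mA) => //; try exact: measurableI.
Qed.

(* The selected tiles are grown from the side of a cut where [h] has positive
   integral until the integral vanishes, as in the rising sun lemma; what is
   left then has nonpositive integral and lies on the other side of the cut. *)
Lemma rising_sun_tiling (cs : seq (bool * R)) Q (h : T -> R) :
  measurable Q -> bounded_coords Q -> mu.-integrable Q (EFin \o h) ->
  \int[mu]_(x in Q) h x <= 0 ->
  exists2 L, tiles Q L & forall P, P \in L ->
    \int[mu]_(x in P) h x = 0 \/
    (\int[mu]_(x in P) h x <= 0 /\ forall c, c \in cs -> uncrossed c P).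
Proof.
elim: cs Q => [|[b s] cs IH] Q mQ bQ iQ hQ.
  by exists [:: Q]; [exact: tile1|move=> P; rewrite inE => /eqP ->; right].
have mI c : measurable (Q `&` halfplane c).
  by apply: measurableI => //; exact: measurable_halfplane.
have mD c : measurable (Q `&` ~` halfplane c).
  by apply: measurableI => //; apply: measurableC; exact: measurable_halfplane.
have bS B : B `<=` Q -> bounded_coords B.
  by move=> BQ; case: bQ => M QM; exists M => x b' /BQ; exact: QM.
have iS B : measurable B -> B `<=` Q -> mu.-integrable B (EFin \o h).
  by move=> mB BQ; apply: (integrableS mQ).
pose F r := \int[mu]_(x in Q `&` halfplane (b, r)) h x.
have cF : continuous F by exact: continuous_Rintegral_halfplane.
have [M QM] := bQ.
have FM r : M <= r -> F r = \int[mu]_(x in Q) h x.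
  move=> Mr; rewrite /F; congr Rintegral; apply/seteqP; split=> x; first by case.
  by move=> Qx; split=> //; rewrite /halfplane /=; apply: le_trans Mr;
    apply: le_trans (QM _ b Qx); rewrite ler_norm.
have FNM r : r < - M -> F r = 0.
  move=> rM; rewrite /F (_ : Q `&` _ = set0) ?Rintegral_set0//.
  rewrite -subset0 => x [Qx]; rewrite /halfplane /= => xr.
  have := QM _ b Qx; rewrite ler_norml => /andP[Mx _].
  by have := le_lt_trans (le_trans Mx xr) rM; rewrite ltxx.
(* A piece that the cut [(b, s)] does not cross only needs the remaining cuts, because its tiles
   stay inside it and remain uncrossed. *)
have IHsub B : measurable B -> B `<=` Q -> uncrossed (b, s) B ->
    \int[mu]_(x in B) h x <= 0 ->
    exists2 L, tiles B L & forall P, P \in L -> \int[mu]_(x in P) h x = 0 \/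
      (\int[mu]_(x in P) h x <= 0 /\
       forall c, c \in (b, s) :: cs -> uncrossed c P).
  move=> mB BQ uB hB; have [L tL HL] := IH B mB (bS _ BQ) (iS _ mB BQ) hB.
  exists L => // P PL; have [|[hP uP]] := HL _ PL; [by left|right].
  split=> // c; rewrite inE => /orP[/eqP->|]; last exact: uP.
  have PB := tiles_subset tL PL.
  by case: uB => uB; [left|right]; apply: subset_trans uB.
have HQ := Rintegral_cut (b, _) mQ iQ.
have [Fs|Fs] := ltP 0 (F s).
  have sM : s <= Num.max s M by rewrite le_max lexx.
  (* [F] is positive at [s], and from [M] on it equals the integral over all of [Q], which is
     nonpositive; so it vanishes at some [r >= s]. The grown side contains the whole lower side of
     the cut. *)
  have [||r] := @IVT R F s (Num.max s M) 0 sM.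
  - by apply: continuous_subspaceT.
  - have FMx : F (Num.max s M) <= 0 by rewrite FM ?le_max ?lexx ?orbT.
    by rewrite ge_min le_max FMx (ltW Fs) orbT.
  rewrite in_itv /= => /andP[sr _] Fr.
  have [||||L tL HL] := IHsub (Q `&` ~` halfplane (b, r)) => //.
  - by right=> x [_]; rewrite /halfplane /=; apply: contra_not => xs;
      exact: le_trans sr.
  - by move: hQ; rewrite (HQ r) -/(F r) Fr add0r.
  exists ([:: Q `&` halfplane (b, r)] ++ L).
    by apply: tile_cut; [exact: tile1|exact: tL].
  by move=> P; rewrite mem_cat inE => /orP[/eqP ->|/HL//]; left.
have [Gs|Gs] := ltP 0 (\int[mu]_(x in Q `&` ~` halfplane (b, s)) h x).
  have Ms : Num.min s (- M - 1) <= s by rewrite ge_min lexx.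
  have FN : F (Num.min s (- M - 1)) = 0.
    by apply: FNM; rewrite gt_min; apply/orP; right; lra.
  have HQs := HQ s; rewrite -/(F s) in HQs.
  (* Here the upper side grows downwards: its integral vanishes when [F r] is the integral over [Q].
     This value lies between [F s] and 0, the value of [F] strictly below [- M], whence the endpoint
     [- M - 1]. *)
  have [||r] := @IVT R F _ _ (\int[mu]_(x in Q) h x) Ms.
  - by apply: continuous_subspaceT.
  - rewrite FN ge_min le_max hQ andbT; apply/orP; right.
    by rewrite HQs lerDl ltW.
  rewrite in_itv /= => /andP[_ rs] Fr.
  have [||||L tL HL] := IHsub (Q `&` halfplane (b, r)) => //.
  - by left=> x [_]; rewrite /halfplane /= => xr; exact: le_trans rs.
  - by rewrite -/(F r) Fr.
  exists (L ++ [:: Q `&` ~` halfplane (b, r)]).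
    by apply: tile_cut; [exact: tL|exact: tile1].
  move=> P; rewrite mem_cat orbC inE => /orP[/eqP ->|/HL//]; left.
  by have := HQ r; rewrite -/(F r) Fr => /eqP; rewrite -subr_eq0 opprD addrA subrr sub0r oppr_eq0 => /eqP.
(* Neither side has positive integral: the cut is made at [s] itself and both sides are treated
   further. *)
have [|||L1 tL1 HL1] := IHsub (Q `&` halfplane (b, s)) (mI _) => //.
  by left=> x [].
have [|||L2 tL2 HL2] := IHsub (Q `&` ~` halfplane (b, s)) (mD _) => //.
  by right=> x [].
exists (L1 ++ L2); first exact: tile_cut tL1 tL2.
by move=> P; rewrite mem_cat => /orP[/HL1|/HL2].
Qed.

End tilings.

Import HBSimple HBNNSimple.

(** * Density in L^q of functions constant on the cells of a finite grid *)

Section adapted_approximation.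
Context {R : realType}.
Local Notation T := (measurableTypeR R * measurableTypeR R)%type.
Implicit Types (A B : set T) (cs : seq (bool * R)) (f g s : T -> R).

(** Two points on the same side of every line of [cs] share a cell of the grid. The codomain is
    arbitrary so that, with values in [Prop], the notion also covers unions of cells. *)
Definition adapted cs {U : Type} (s : T -> U) :=
  forall x y, (forall c, c \in cs -> halfplane c x <-> halfplane c y) ->
    s x = s y.

Lemma adapted_uncrossed cs (U : Type) (s : T -> U) (P : set T) :
  adapted cs s -> (forall c, c \in cs -> uncrossed c P) ->
  forall x y, P x -> P y -> s x = s y.
Proof.
move=> ads uP x y Px Py; apply: ads => c /uP[] PH.
  by split=> _; exact: PH.
by split=> h; [case: (PH x Px)|case: (PH y Py)].
Qed.

Lemma adapted_comp2 cs1 cs2 (U V W : Type) (s1 : T -> U) (s2 : T -> V)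
    (op : U -> V -> W) :
  adapted cs1 s1 -> adapted cs2 s2 ->
  adapted (cs1 ++ cs2) (fun x => op (s1 x) (s2 x)).
Proof.
move=> a1 a2 x y h; rewrite (a1 x y) ?(a2 x y)// => c hc.
  by apply: h; rewrite mem_cat hc orbT.
by apply: h; rewrite mem_cat hc.
Qed.

(** |x + y| is at most twice the larger of |x| and |y|, and the power of a maximum is at most the
    sum of the powers. *)
Lemma powR_normD_le (q x y : R) : 0 <= q ->
  `|x + y| `^ q <= 2 `^ q * (`|x| `^ q + `|y| `^ q).
Proof.
move=> q0; apply: (@le_trans _ _ ((2 * Num.max `|x| `|y|) `^ q)).
  apply: ge0_ler_powR => //; rewrite ?nnegrE ?mulr_ge0 ?le_max ?normr_ge0//.
  rewrite (le_trans (ler_normD _ _))// mulr_natl mulr2n lerD//.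
    by rewrite le_max lexx.
  by rewrite le_max lexx orbT.
rewrite powRM// ?le_max ?normr_ge0// ler_wpM2l ?powR_ge0//.
by rewrite /Num.max; case: ifP => _; rewrite ?lerDr ?lerDl powR_ge0.
Qed.

Lemma cvge0_lt (u : nat -> \bar R) (e : R) : u n @[n --> \oo] --> 0%E -> 0 < e ->
  \forall n \near \oo, (u n < e%:E)%E.
Proof.
move=> /fine_cvgP[ufin /cvgrPdist_lt cu] e0; near=> n.
have : `|0 - fine (u n)| < e by near: n; exact: cu.
rewrite sub0r normrN => /(le_lt_trans (ler_norm _)).
by rewrite -lte_fin fineK//; near: n.
Unshelve. all: by end_near. Qed.

Lemma cvg_powR0 (q : R) (u : nat -> R) : 0 < q -> (forall n, 0 <= u n) ->
  u n @[n --> \oo] --> 0 -> u n `^ q @[n --> \oo] --> 0.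
Proof.
move=> q0 u0 cu; apply/cvgrPdist_lt => e e0.
have e'0 : 0 < e `^ q^-1 by rewrite powR_gt0.
near=> n; rewrite sub0r normrN ger0_norm ?powR_ge0//.
rewrite -[ltRHS]powRr1 ?(ltW e0)// -(@mulVf _ q) ?gt_eqF// powRrM.
rewrite gt0_ltr_powR ?nnegrE ?powR_ge0// -[ltLHS]ger0_norm//.
rewrite -normrN -[X in `|X|]sub0r; near: n.
by move/cvgrPdist_lt : cu; exact.
Unshelve. all: by end_near. Qed.

Variable mu : {measure set T -> \bar R}.
Variable A : set T.
Hypothesis mA : measurable A.
Hypothesis muA : (mu A < +oo)%E.

Let symdiff B C := (B `\` C) `|` (C `\` B).

(** Sets that can be approximated in measure, inside [A], by unions of cells of finite grids. They
    contain the half-planes and form a sigma-algebra, hence include all measurable sets. Countable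
    unions reduce to finite ones by continuity of [mu] from above, where [mu A < +oo] enters. *)
Let approximable B := measurable B /\ forall e : R, 0 < e ->
  exists C, [/\ measurable C, exists cs, adapted cs (C : T -> Prop) &
    (mu (A `&` symdiff B C) < e%:E)%E].

Let measurable_symdiff B C : measurable B -> measurable C ->
  measurable (symdiff B C).
Proof. by move=> mB mC; apply: measurableU; exact: measurableD. Qed.

Let approximable_halfplane c : approximable (halfplane c).
Proof.
have mc := measurable_halfplane c; split=> // e e0.
exists (halfplane c); split=> //.
  exists [:: c] => x y /(_ c); rewrite inE eqxx => /(_ isT) h.
  exact/propext.
by rewrite /symdiff setDv setUid setI0 measure0 lte_fin.
Qed.

Let approximableC B : approximable B -> approximable (~` B).
Proof.
move=> [mB aB]; split; first exact: measurableC.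
move=> e /aB[C [mC [cs aC] muC]]; exists (~` C); split.
- exact: measurableC.
- by exists cs => x y h; rewrite /setC /=; congr not; exact: aC.
- rewrite (_ : symdiff _ _ = symdiff B C) // /symdiff setUC.
  by congr (_ `|` _); apply/seteqP; split=> x [] //=; rewrite ?notK;
    tauto.
Qed.

Let approximableU B1 B2 :
  approximable B1 -> approximable B2 -> approximable (B1 `|` B2).
Proof.
move=> [mB1 aB1] [mB2 aB2]; split; first exact: measurableU.
move=> e e0; have e20 : 0 < e / 2 by rewrite divr_gt0.
have [C1 [mC1 [cs1 aC1] muC1]] := aB1 _ e20.
have [C2 [mC2 [cs2 aC2] muC2]] := aB2 _ e20.
exists (C1 `|` C2); split; first exact: measurableU.
  exists (cs1 ++ cs2); exact: (adapted_comp2 or aC1 aC2).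
have mS1 := measurable_symdiff mB1 mC1; have mS2 := measurable_symdiff mB2 mC2.
apply: (@le_lt_trans _ _ (mu (A `&` symdiff B1 C1 `|` A `&` symdiff B2 C2))).
  apply: le_measure; rewrite ?inE; try (apply: measurableI => //).
  - by apply: measurable_symdiff; exact: measurableU.
  - by apply: measurableU; exact: measurableI.
  - by move=> x [Ax]; rewrite /symdiff /setD /setU /setI /=; tauto.
rewrite (splitr e) EFinD.
apply: (@le_lt_trans _ _ (mu (A `&` symdiff B1 C1) + mu (A `&` symdiff B2 C2))%E).
  by apply: measureU2; exact: measurableI.
exact: lteD.
Qed.

Let approximable0 : approximable set0.
Proof.
split=> // e e0; exists set0; split=> //; first by exists [::].
by rewrite /symdiff setDv setUid setI0 measure0 lte_fin.
Qed.

Let approximable_bigcup (B : (set T)^nat) :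
  (forall n, approximable (B n)) -> approximable (\bigcup_n B n).
Proof.
move=> aB; have mB : measurable (\bigcup_n B n).
  by apply: bigcup_measurable => n _; case: (aB n).
split=> // e e0; have e20 : 0 < e / 2 by rewrite divr_gt0.
pose C n := \big[setU/set0]_(i < n) B i.
have aC n : approximable (C n).
  by rewrite /C; elim/big_ind : _ => // *; exact: approximableU.
pose D n := A `&` (\bigcup_k B k `\` C n).
have mD n : measurable (D n).
  apply: measurableI => //; apply: measurableD => //; exact: (aC n).1.
have D0 : \bigcap_n D n = set0.
  rewrite -subset0 => x Dx; have [_ [[k _ Bkx] _]] := Dx 0%N I.
  have [_ [_]] := Dx k.+1 I; apply.
  by rewrite /C -bigcup_mkord; exists k => /=.
have cvgD : mu (D n) @[n --> \oo] --> 0%E.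
  rewrite -(measure0 mu) -D0; apply: nonincreasing_cvg_mu => //.
  - rewrite (le_lt_trans _ muA)//; apply: le_measure; rewrite ?inE//.
    by move=> x [].
  - by rewrite D0.
  - move=> m n mn; apply/subsetPset => x [Ax [Bx Cx]]; split=> //; split=> //.
    apply: contra_not Cx; rewrite /C -!bigcup_mkord => -[k /= km Bk].
    by exists k => //=; exact: leq_trans mn.
have [n _ /(_ n (leqnn n)) muDn] := cvge0_lt cvgD e20.
have [E [mE aE muE]] := (aC n).2 _ e20.
exists E; split => //.
have mS := measurable_symdiff (aC n).1 mE.
apply: (@le_lt_trans _ _ (mu (D n `|` A `&` symdiff (C n) E))).
  apply: le_measure; rewrite ?inE.
  - by apply: measurableI => //; exact: measurable_symdiff.
  - by apply: measurableU => //; exact: measurableI.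
  - have CB : C n `<=` \bigcup_k B k.
      by rewrite /C -bigcup_mkord => x [k _ Bk]; exists k.
    move=> x [Ax] [[Bx nEx]|[Ex nBx]].
      have [Cx|nCx] := pselect (C n x); last by left.
      by right; split=> //; left.
    by right; split=> //; right; split=> // /CB.
rewrite (splitr e) EFinD.
apply: (@le_lt_trans _ _ (mu (D n) + mu (A `&` symdiff (C n) E))%E).
  by apply: measureU2 => //; exact: measurableI.
exact: lteD.
Qed.

Let measurable_approximable B : measurable B -> approximable B.
Proof.
(* Open rays []r, +oo[] generate the Borel sets of the line, and their preimages under a coordinate
   are complements of half-planes; preimages under the two coordinates generate the product. *)
have sigma_pre b : forall X, measurable X ->
    approximable ((coord b) @^-1` X).
  suff: (R.-ocitv.-measurable).-sigma.-measurable `<=`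
      [set X | approximable (coord b @^-1` X)] by apply.
  rewrite RGenOInfty.measurableE; apply: smallest_sub; first split => /=.
  - by rewrite preimage_set0.
  - by move=> Y aY; rewrite setTD preimage_setC; exact: approximableC.
  - by move=> F aF; rewrite preimage_bigcup; exact: approximable_bigcup.
  - move=> _ [r ->] /=; rewrite (_ : _ @^-1` _ = ~` halfplane (b, r)).
      exact/approximableC/approximable_halfplane.
    apply/seteqP; split=> x; rewrite /halfplane /= in_itv /= andbT ltNge;
      by move/negP.
move: B; apply: smallest_sub; first split=> //.
- by move=> Y aY; rewrite setTD; exact: approximableC.
- rewrite subUset; split=> _ [X mX <-]; rewrite setTI.
    exact: (sigma_pre true).
  exact: (sigma_pre false).
Qed.

Variable q : R.
Hypothesis q0 : 0 < q.

Let approxf f := forall e : R, 0 < e -> exists s,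
  [/\ measurable_fun setT s, exists cs, adapted cs s &
      (\int[mu]_(x in A) (`|f x - s x| `^ q)%:E < e%:E)%E].

Let measurable_powdiff D f g : measurable_fun D f -> measurable_fun D g ->
  measurable_fun D (fun x => (`|f x - g x| `^ q)%:E).
Proof.
move=> mf mg; apply/measurable_EFinP.
apply: (measurableT_comp (measurable_powR q)).
by apply: measurableT_comp => //; exact: measurable_funB.
Qed.

Let approxfD f g f' g' :
  measurable_fun setT f -> measurable_fun setT g ->
  measurable_fun setT f' -> measurable_fun setT g' ->
  (\int[mu]_(x in A) (`|(f x + g x) - (f' x + g' x)| `^ q)%:E <=
   (2 `^ q)%:E * (\int[mu]_(x in A) (`|f x - f' x| `^ q)%:E +
    \int[mu]_(x in A) (`|g x - g' x| `^ q)%:E))%E.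
Proof.
move=> mf mg mf' mg'.
have mm (h : T -> R) : measurable_fun setT h -> measurable_fun A h.
  exact: measurable_funTS.
rewrite -ge0_integralD//; try (by move=> *; rewrite lee_fin powR_ge0); try
  exact: measurable_powdiff (mm _ _) (mm _ _).
rewrite -ge0_integralZl ?lee_fin ?powR_ge0//; last 2 first.
- by apply: emeasurable_funD; apply: measurable_powdiff; exact: mm.
- by move=> x _; rewrite adde_ge0// lee_fin powR_ge0.
apply: ge0_le_integral => //.
- by apply: measurable_powdiff; apply: mm; exact: measurable_funD.
- apply: measurable_funeM; apply: emeasurable_funD;
    by apply: measurable_powdiff; exact: mm.
- move=> x _; rewrite -EFinD -EFinM lee_fin.
  rewrite (_ : _ - _ = (f x - f' x) + (g x - g' x)); last by ring.
  exact: powR_normD_le (ltW q0).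
Qed.

Let approxf_add f g : measurable_fun setT f -> measurable_fun setT g ->
  approxf f -> approxf g -> approxf (fun x => f x + g x).
Proof.
move=> mf mg af ag e e0.
have p20 : 0 < 2 `^ q by rewrite powR_gt0.
have e20 : 0 < e / 2 / 2 `^ q by rewrite !divr_gt0.
have [s [ms [cs as_] hs]] := af _ e20; have [t [mt [ct at_] ht]] := ag _ e20.
exists (fun x => s x + t x); split; first exact: measurable_funD.
  by exists (cs ++ ct); exact: (adapted_comp2 +%R as_ at_).
apply: le_lt_trans (approxfD mf mg ms mt) _.
rewrite -(@lte_pdivlMl _ (2 `^ q)) //.
rewrite (_ : _ * _ = (e / 2 / 2 `^ q)%:E + (e / 2 / 2 `^ q)%:E)%E.
  exact: (lteD hs ht).
by rewrite -EFinM -EFinD; congr EFin; rewrite -mulrDl -splitr mulrC.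
Qed.

Let approxf_lim f : measurable_fun setT f ->
  (forall e : R, 0 < e -> exists g, [/\ measurable_fun setT g, approxf g &
    (\int[mu]_(x in A) (`|f x - g x| `^ q)%:E < e%:E)%E]) ->
  approxf f.
Proof.
move=> mf lf e e0.
have p20 : 0 < 2 `^ q by rewrite powR_gt0.
have e20 : 0 < e / 2 / 2 `^ q by rewrite !divr_gt0.
have [g [mg ag hg]] := lf _ e20; have [s [ms as_ hs]] := ag _ e20.
exists s; split => //.
(* The error is split as f - s = (f - g) + (g - s), the first term being approximated by 0. *)
have := @approxfD (fun x => f x - g x) (fun x => g x) (cst 0) s.
under eq_integral do rewrite add0r subrK.
under [X in (_ <= _ * (X + _))%E]eq_integral do rewrite subr0.
move=> h; apply: le_lt_trans (h _ _ _ _) _ => //; first exact: measurable_funB.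
rewrite -(@lte_pdivlMl _ (2 `^ q)) //.
rewrite (_ : _ * _ = (e / 2 / 2 `^ q)%:E + (e / 2 / 2 `^ q)%:E)%E.
  exact: (lteD hg hs).
by rewrite -EFinM -EFinD; congr EFin; rewrite -mulrDl -splitr mulrC.
Qed.

Let approxf0 : approxf (cst 0).
Proof.
move=> e e0; exists (cst 0); split=> //; first by exists [::].
under eq_integral do rewrite subrr normr0 powR0 ?gt_eqF//.
by rewrite integral0 lte_fin.
Qed.

Let approxf_indic v B : measurable B -> approxf (fun x => v * \1_B x).
Proof.
move=> mB e e0.
have v0 : 0 < `|v| `^ q + 1 by rewrite ltr_wpDl ?powR_ge0.
have [C [mC [cs aC] muC]] := (measurable_approximable mB).2 _ (divr_gt0 e0 v0).
exists (fun x => v * \1_C x); split.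
- by apply: measurable_funM => //; exact: measurable_indic.
- exists cs => x y /aC; rewrite !indicE => Cxy.
  by congr (_ * (_ : bool)%:R); apply/idP/idP; rewrite !inE Cxy.
have mS := measurable_symdiff mB mC.
rewrite (eq_integral (fun x => (`|v| `^ q)%:E * (\1_(symdiff B C) x)%:E)%E).
  rewrite ge0_integralZl//; last by apply/measurable_EFinP.
  rewrite integral_indic// setIC.
  apply: (@le_lt_trans _ _ ((`|v| `^ q + 1)%:E * mu (A `&` symdiff B C))%E).
    by apply: lee_pmul => //; rewrite lee_fin ?powR_ge0// lerDl.
  by rewrite -lte_pdivlMl// -EFinM mulrC.
move=> x _; rewrite -EFinM; congr EFin.
rewrite -mulrBr normrM powRM//; congr (_ * _); rewrite !indicE.
have [Bx|Bx] := boolP (x \in B); have [Cx|Cx] := boolP (x \in C).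
- rewrite subrr normr0 powR0 ?gt_eqF// memNset//.
  by move: Bx Cx; rewrite !inE /symdiff /setD /setU /=; tauto.
- rewrite subr0 normr1 powR1 mem_set//.
  by move: Bx Cx; rewrite !inE !notin_setE /symdiff /setD /setU /=; tauto.
- rewrite sub0r normrN normr1 powR1 mem_set//.
  by move: Bx Cx; rewrite !inE !notin_setE /symdiff /setD /setU /=; tauto.
- rewrite subrr normr0 powR0 ?gt_eqF// memNset//.
  by move: Bx Cx; rewrite !notin_setE /symdiff /setD /setU /=; tauto.
Qed.

Let approxf_simple (f : {nnsfun T >-> R}) v : approxf (fun x => v * f x).
Proof.
have mpre y : measurable (f @^-1` [set y]).
  by rewrite -[X in measurable X]setTI; exact: measurable_funP.
have [n [c fE]] : exists (n : nat) (c : nat -> R), forall x,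
    f x = \sum_(i < n) c i * \1_(f @^-1` [set c i]) x.
  by do 2 eexists; exact: fimfunEord.
rewrite (_ : (fun x => v * f x) = fun x =>
    \sum_(i < n) v * c i * \1_(f @^-1` [set c i]) x); last first.
  by apply/funext => x; rewrite fE mulr_sumr; under eq_bigr do rewrite mulrA.
elim: n {fE} => [|n IH].
  under eq_fun do rewrite big_ord0; exact: approxf0.
under eq_fun do rewrite big_ord_recr /=.
have mind i : measurable_fun setT (fun x : T =>
    v * c i * \1_(f @^-1` [set c i]) x).
  by apply: measurable_funM => //; exact: measurable_indic.
apply: approxf_add; last exact: approxf_indic.
- by apply: measurable_sum => z.
- exact: mind.
- exact: IH.
Qed.

(** Increasing simple functions below [f] converge in the sense of q-th powers by dominated
    convergence, with bound |v|^q |f|^q. The factor [v] is there for the value -1, which brings in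
    negative parts. *)
Let approxf_ge0 f v : measurable_fun setT f -> (forall x, 0 <= f x) ->
  (\int[mu]_(x in A) (`|f x| `^ q)%:E < +oo)%E -> approxf (fun x => v * f x).
Proof.
move=> mf f0 intf; apply: approxf_lim; first exact: measurable_funM.
move=> e e0.
have mEf : measurable_fun setT (EFin \o f) by exact/measurable_EFinP.
pose g := nnsfun_approx measurableT mEf.
have g_f x : g ^~ x @ \oo --> f x.
  have := @cvg_nnsfun_approx _ T R setT measurableT _ mEf
    (fun x _ => f0 x) x I.
  by move=> /fine_cvgP[].
have gf n x : g n x <= f x.
  have nd := @nd_nnsfun_approx _ T R setT measurableT _ mEf.
  have := nondecreasing_cvgn_le _ (cvgP _ (g_f x)) n.
  rewrite (cvg_lim _ (g_f x))//; apply => m k mk.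
  by have /lefP := nd _ _ mk; apply.
have mfg n : measurable_fun A (fun x => (`|v * f x - v * g n x| `^ q)%:E).
  by apply: measurable_powdiff; apply: measurable_funTS;
    apply: measurable_funM.
have mfq : measurable_fun A (fun x => (`|f x| `^ q)%:E).
  apply/measurable_EFinP; apply: (measurableT_comp (measurable_powR q)).
  by apply: measurableT_comp => //; exact: measurable_funTS.
have [|||[_ _ /= cvg0]] := @dominated_convergence _ T R mu A mA
   (fun n x => (`|v * f x - v * g n x| `^ q)%:E) (cst 0)%E
   (fun x => ((`|v| `^ q)%:E * (`|f x| `^ q)%:E))%E mfg (measurable_cst _).
- apply: nearW => x _; rewrite /cst /=.
  have h : `|v * f x - v * g n x| @[n --> \oo] --> (0 : R).
    rewrite -(@normr0 _ R) -(subrr (v * f x)).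
    by apply: cvg_norm; apply: cvgB; [exact: cvg_cst|apply: cvgMr; exact: g_f].
  by apply: cvg_EFin; [exact: nearW|exact: cvg_powR0 q0 _ h].
- by apply: integrableZl => //; apply/integrableP; split=> //;
    under eq_integral do rewrite /= ger0_norm ?powR_ge0//.
- apply: nearW => x n _; rewrite -EFinM /= lee_fin ger0_norm ?powR_ge0//.
  rewrite -powRM// ge0_ler_powR ?nnegrE ?mulr_ge0 ?(ltW q0)//.
  rewrite -mulrBr normrM ler_wpM2l// !ger0_norm ?subr_ge0 ?gf//.
  by rewrite gerBl.
rewrite integral0 in cvg0.
have [n _ /(_ n (leqnn n)) hn] := cvge0_lt cvg0 e0.
exists (fun x => v * g n x); split; last exact: hn.
  exact: measurable_funM.
exact: approxf_simple.
Qed.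

Lemma adapted_dense f (e : R) : measurable_fun setT f ->
  (\int[mu]_(x in A) (`|f x| `^ q)%:E < +oo)%E -> 0 < e ->
  exists s, [/\ measurable_fun setT s, exists cs, adapted cs s &
      (\int[mu]_(x in A) (`|f x - s x| `^ q)%:E < e%:E)%E].
Proof.
move=> mf intf; move: e.
have mle (g : T -> R) : measurable_fun setT g -> (forall x, `|g x| <= `|f x|) ->
    (\int[mu]_(x in A) (`|g x| `^ q)%:E < +oo)%E.
  have mA' (k : T -> R) : measurable_fun setT k ->
      measurable_fun A (fun x => (`|k x| `^ q)%:E).
    move=> mk; apply/measurable_EFinP; apply: (measurableT_comp (measurable_powR q)).
    by apply: measurableT_comp => //; exact: measurable_funTS.
  move=> mg gf; apply: le_lt_trans intf; apply: ge0_le_integral => //.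
  - exact: mA'.
  - exact: mA'.
  - by move=> x _; rewrite lee_fin ge0_ler_powR ?nnegrE// ltW.
have fE x : `|f x| = f^\+ x + f^\- x by have /(congr1 (@^~ x)) := funrposDneg f.
have mp := measurable_funrpos mf; have mn := measurable_funrneg mf.
rewrite (_ : f = fun x => 1 * f^\+ x + (-1) * f^\- x); last first.
  apply/funext => x; rewrite mul1r mulN1r.
  by have /(congr1 (@^~ x)) := funrposBneg f.
apply: approxf_add; [exact: measurable_funM|exact: measurable_funM| |].
- apply: approxf_ge0; [exact: mp|exact: funrpos_ge0|].
  by apply: mle => // x; rewrite fE ger0_norm ?funrpos_ge0// lerDl funrneg_ge0.
- apply: approxf_ge0; [exact: mn|exact: funrneg_ge0|].
  by apply: mle => // x; rewrite fE ger0_norm ?funrneg_ge0// lerDr funrpos_ge0.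
Qed.

End adapted_approximation.

(** * Rectangles under cuts *)

Section rectangles.
Context {R : realType}.
Local Notation T := (measurableTypeR R * measurableTypeR R)%type.
Implicit Types (A : set T) (c : bool * R).

Lemma rectangle_measurable A : rectangle A -> measurable A.
Proof.
move=> [I [J [[iI _] _ [iJ _] _ ->]]].
by apply: measurableX; exact: is_interval_measurable.
Qed.

Lemma rectangle_bounded A : rectangle A -> bounded_coords A.
Proof.
move=> [I [J [[_ [M1 [_ bI]]] _ [_ [M2 [_ bJ]]] _ ->]]].
(* [bounded_set] gives a bound by every number strictly above [M1], hence the [+ 1]. *)
exists (Num.max (M1 + 1) (M2 + 1)) => x b [xI xJ]; rewrite le_max.
have h1 : `|x.1| <= M1 + 1 by apply: bI; rewrite ?ltrDl.
have h2 : `|x.2| <= M2 + 1 by apply: bJ; rewrite ?ltrDl.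
by case: b; rewrite /= ?h1 ?h2 ?orbT.
Qed.

Lemma is_intervalI (I J : set R) :
  is_interval I -> is_interval J -> is_interval (I `&` J).
Proof.
move=> iI iJ x y [Ix Jx] [Iy Jy] z xzy; split.
  exact: iI Ix Iy _ xzy.
exact: iJ Jx Jy _ xzy.
Qed.

Lemma rectangle_cut A c : rectangle A ->
  rectangle (A `&` halfplane c) /\ rectangle (A `&` ~` halfplane c).
Proof.
case: c => b s [I [J [[iI bI] I0 [iJ bJ] J0 ->]]].
have itvI (K : set R) (k : interval R) : is_interval K /\ bounded_set K ->
    is_interval (K `&` [set` k]) /\ bounded_set (K `&` [set` k]).
  move=> [iK bK]; split; first exact: (is_intervalI iK (@interval_is_interval _ k)).
  by case: bK => M [Mr bK]; exists M; split=> // N /bK KN x [Kx _]; exact: KN.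
have sub0 (K : set R) (k : interval R) : K `<=` `]0, +oo[ -> K `&` [set` k] `<=` `]0, +oo[.
  by move=> K0 x [/K0].
have cI : is_interval I /\ bounded_set I by [].
have cJ : is_interval J /\ bounded_set J by [].
have gt_half x : (~ (x <= s)) <-> (s < x) by rewrite ltNge; split=> /negP.
case: b; split.
- exists (I `&` `]-oo, s]), J; split; [exact: itvI|exact: sub0|by []|by []|].
  by apply/seteqP; split=> -[x y]; rewrite /halfplane /= in_itv /=; tauto.
- exists (I `&` `]s, +oo[), J; split; [exact: itvI|exact: sub0|by []|by []|].
  apply/seteqP; split=> -[x y]; rewrite /halfplane /= in_itv /= andbT;
    have := gt_half x; tauto.
- exists I, (J `&` `]-oo, s]); split; [by []|by []|exact: itvI|exact: sub0|].
  by apply/seteqP; split=> -[x y]; rewrite /halfplane /= in_itv /=; tauto.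
- exists I, (J `&` `]s, +oo[); split; [by []|by []|exact: itvI|exact: sub0|].
  apply/seteqP; split=> -[x y]; rewrite /halfplane /= in_itv /= andbT;
    have := gt_half y; tauto.
Qed.

Lemma rectangle_tiles A L : tiles A L -> rectangle A ->
  forall P, P \in L -> rectangle P.
Proof. by apply: tiles_hereditary => B c; exact: rectangle_cut. Qed.

End rectangles.

(** * Averages and blocks: unnormalized atoms on a set of finite measure *)

Section blocks.
Context {R : realType}.
Local Notation T := (measurableTypeR R * measurableTypeR R)%type.
Variable mu : {measure set T -> \bar R}.
Implicit Types (A P : set T) (a b : T -> R).

Lemma measurable_fun_big_seq (I : eqType) (r : seq I) (f : I -> T -> R) :
  (forall i, i \in r -> measurable_fun setT (f i)) ->
  measurable_fun setT (fun x => \sum_(i <- r) f i x).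
Proof.
elim: r => [|i r IH] mf.
  by under eq_fun do rewrite big_nil; exact: measurable_cst.
under eq_fun do rewrite big_cons; apply: measurable_funD.
  by apply: mf; rewrite mem_head.
by apply: IH => j jr; apply: mf; rewrite inE jr orbT.
Qed.

Lemma Rintegral_sum P (I : eqType) (r : seq I) (f : I -> T -> R) :
  measurable P -> (forall i, i \in r -> mu.-integrable P (EFin \o f i)) ->
  \int[mu]_(x in P) (\sum_(i <- r) f i x) =
  \sum_(i <- r) \int[mu]_(x in P) f i x.
Proof.
move=> mP fi.
suff [//] : \int[mu]_(x in P) (\sum_(i <- r) f i x) =
    \sum_(i <- r) \int[mu]_(x in P) f i x /\
    mu.-integrable P (EFin \o (fun x => \sum_(i <- r) f i x)).
elim: r fi => [_|i r IH fi].
  rewrite big_nil; under eq_Rintegral do rewrite big_nil.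
  rewrite Rintegral_cst// mul0r; split => //.
  apply: eq_integrable (integrable0 _ _) => // x _.
  by rewrite /= big_nil.
have [|IHe IHi] := IH.
  by move=> j jr; apply: fi; rewrite inE jr orbT.
have fii : mu.-integrable P (EFin \o f i) by apply: fi; rewrite mem_head.
under eq_Rintegral do rewrite big_cons.
rewrite RintegralD// IHe big_cons; split => //.
by apply: eq_integrable (integrableD mP fii IHi) => // x _; rewrite /= big_cons.
Qed.

(** On a null set the average is 0, because the inverse of 0 is 0. *)
Definition avg P a : R := (\int[mu]_(x in P) a x) / fine (mu P).

Variable q : R.
Hypothesis q1 : 1 < q.

(* [k * mu P] is the weight of a block [b]: when it is nonzero, [b] is this
   weight times a [q]-atom. *)
Definition block P (k : R) b :=
  [/\ measurable_fun setT b, forall x, ~ P x -> b x = 0,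
      (\int[mu]_(x in P) (`|b x| `^ q)%:E <= (k `^ q)%:E * mu P)%E &
      \int[mu]_(x in P) b x = 0].

Lemma measurable_normpow P (f : T -> R) : measurable_fun P f ->
  measurable_fun P (fun x => (`|f x| `^ q)%:E).
Proof.
move=> mf; apply/measurable_EFinP; apply: (measurableT_comp (measurable_powR q)).
exact: measurableT_comp.
Qed.

Let q0 : 0 < q. Proof. exact: lt_trans ltr01 q1. Qed.

(** The cases y <= 1 and y >= 1 are separate and trivial. Rescaled by a level k it reads |a| <= k +
    k^(1-q) |a|^q, which replaces Hoelder's inequality at the cost of a factor 2. *)
Lemma le_add_powR (y : R) : 0 <= y -> y <= 1 + y `^ q.
Proof.
move=> y0; have [y1|y1] := leP y 1.
  by rewrite (le_trans y1)// lerDl powR_ge0.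
by rewrite (le_trans (le1r_powR (ltW y1) (ltW q1)))// lerDr.
Qed.

Section finite_cell.
Variables (P : set T).
Hypotheses (mP : measurable P) (muP : (mu P < +oo)%E).

Let fmuP : mu P \is a fin_num. Proof. by rewrite ge0_fin_numE. Qed.

Lemma integrable_normpow a : measurable_fun setT a ->
  (\int[mu]_(x in P) (`|a x| `^ q)%:E < +oo)%E ->
  mu.-integrable P (fun x => (`|a x| `^ q)%:E).
Proof.
move=> ma ia; apply/integrableP; split.
  by apply: measurable_normpow; exact: measurable_funTS.
by under eq_integral do rewrite /= ger0_norm ?powR_ge0//.
Qed.

Lemma integrable_cell_cst (c : R) : mu.-integrable P (EFin \o cst c).
Proof. by apply: measurable_bounded_integrable => //; exact: bounded_cst. Qed.

Lemma integrable_normpow1 a : measurable_fun setT a ->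
  (\int[mu]_(x in P) (`|a x| `^ q)%:E < +oo)%E ->
  mu.-integrable P (EFin \o a).
Proof.
move=> ma ia.
apply: (@le_integrable _ _ _ mu P mP _ (fun x => (1 + `|a x| `^ q)%:E)).
- by apply/measurable_EFinP; exact: measurable_funTS.
- move=> x _; rewrite /= lee_fin [leRHS]ger0_norm ?addr_ge0 ?powR_ge0//.
  exact: le_add_powR.
- exact: (integrableD mP (integrable_cell_cst 1) (integrable_normpow ma ia)).
Qed.

Lemma avgE a : measurable_fun setT a -> avg P a * fine (mu P) = \int[mu]_(x in P) a x.
Proof.
move=> ma; rewrite /avg; have [m0|m0] := eqVneq (fine (mu P)) 0.
  rewrite m0 mulr0 /Rintegral null_set_integral//.
    by apply/measurable_EFinP; exact: measurable_funTS.
  by rewrite -(fineK fmuP) m0.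
by rewrite divfK.
Qed.

(** Integrating |a| <= k + k^(1-q) |a|^q over [P] gives two terms, each at most k times the measure
    of [P]. *)
Lemma norm_avg_le a k : measurable_fun setT a -> 0 < k ->
  (\int[mu]_(x in P) (`|a x| `^ q)%:E <= (k `^ q)%:E * mu P)%E ->
  `|avg P a| <= 2 * k.
Proof.
move=> ma k0 ak.
have ia : (\int[mu]_(x in P) (`|a x| `^ q)%:E < +oo)%E.
  by apply: le_lt_trans ak _; rewrite -(fineK fmuP) -EFinM ltry.
have ia1 := integrable_normpow1 ma ia; have iaq := integrable_normpow ma ia.
have kq0 : 0 < k `^ q by rewrite powR_gt0.
have [m0|m0] := eqVneq (fine (mu P)) 0.
  by rewrite /avg m0 invr0 mulr0 normr0 mulr_ge0// ltW.
have {}m0 : 0 < fine (mu P) by rewrite lt_neqAle eq_sym m0/= fine_ge0.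
rewrite /avg normrM normfV (gtr0_norm m0) ler_pdivrMr//.
apply: le_trans (le_normr_Rintegral mP ia1) _.
apply: (@le_trans _ _ (\int[mu]_(x in P) (k + k / k `^ q * `|a x| `^ q))).
  apply: le_Rintegral => //.
  - exact: integrable_norm.
  - exact: (integrableD mP (integrable_cell_cst k)
      (integrableZl mP (k / k `^ q) iaq)).
  - move=> x _; have := @le_add_powR (`|a x| / k).
    rewrite divr_ge0 ?(ltW k0)// => /(_ isT).
    rewrite powRM ?invr_ge0 ?(ltW k0)// -(ler_pM2l k0).
    rewrite mulrCA divff ?gt_eqF// mulr1 mulrDr mulr1 => /le_trans; apply.
    rewrite lerD2l -[k^-1]powR_inv1 ?(ltW k0)// -powRrM mulN1r powRN.
    by rewrite le_eqVlt; apply/orP; left; apply/eqP; ring.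
rewrite RintegralD//; last 2 first.
- exact: integrable_cell_cst.
- exact: (integrableZl mP (k / k `^ q) iaq).
rewrite Rintegral_cst// RintegralZl// -[2 * k * _]mulrA mulr_natl mulr2n lerD2l.
rewrite -ler_pdivlMl ?divr_gt0// invfM invrK mulrA.
rewrite (_ : _ * _ * _ = k `^ q * fine (mu P)); last first.
  by field; rewrite gt_eqF.
rewrite -lee_fin /Rintegral fineK ?EFinM ?fineK//.
exact: integrable_fin_num.
Qed.

(** Subtracting a constant from [a] does not change its deviation from its average, so the size may
    be measured after subtracting any [c]: 0 on a critical tile, the value of the approximating
    function on a cell. The constant 8 comes from 2^q (k^q + (2k)^q) <= (8k)^q. *)
Lemma block_sub_avg a c k : measurable_fun setT a -> 0 < k ->
  (\int[mu]_(x in P) (`|a x - c| `^ q)%:E <= (k `^ q)%:E * mu P)%E ->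
  block P (8 * k) (fun x => (a x - avg P a) * \1_P x).
Proof.
move=> ma k0 ak; pose f x := a x - c.
have mf : measurable_fun setT f by exact: measurable_funB.
have ifq : (\int[mu]_(x in P) (`|f x| `^ q)%:E < +oo)%E.
  by apply: le_lt_trans ak _; rewrite -(fineK fmuP) -EFinM ltry.
have if1 := integrable_normpow1 mf ifq; have ifq' := integrable_normpow mf ifq.
have ia : mu.-integrable P (EFin \o a).
  have := integrableD mP if1 (integrable_cell_cst c).
  by apply: eq_integrable => // x _; rewrite /f /= -EFinD subrK.
have mb : measurable_fun setT (fun x => (a x - avg P a) * \1_P x).
  by apply: measurable_funM; [exact: measurable_funB|exact: measurable_indic].
have b1 x : P x -> (a x - avg P a) * \1_P x = a x - avg P a.
  by move=> Px; rewrite indicE mem_set// mulr1.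
split => //.
- by move=> x nPx; rewrite indicE memNset// mulr0.
- have [m0|m0] := eqVneq (mu P) 0%E.
    rewrite m0 mule0 null_set_integral//.
    by apply: measurable_normpow; exact: measurable_funTS.
  have {}m0 : 0 < fine (mu P) by rewrite fine_gt0// muP andbT lt0e m0 measure_ge0.
  have avgf : avg P a - c = avg P f.
    rewrite /avg RintegralB//; last exact: integrable_cell_cst.
    by rewrite Rintegral_cst// mulrBl mulfK ?gt_eqF.
  have fk := norm_avg_le mf k0 ak.
  apply: (@le_trans _ _ (\int[mu]_(x in P)
     ((2 `^ q)%:E * ((`|f x| `^ q)%:E + ((2 * k) `^ q)%:E)))%E).
    apply: ge0_le_integral => //.
    + by apply: measurable_normpow; exact: measurable_funTS.
    + apply: measurable_funeM; apply: emeasurable_funD => //.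
      by apply: measurable_normpow; exact: measurable_funTS.
    + move=> x Px; rewrite b1// -EFinD -EFinM lee_fin.
      rewrite (_ : _ - _ = f x + (- avg P f)); last by rewrite -avgf /f; ring.
      apply: le_trans (powR_normD_le _ _ (ltW q0)) _.
      rewrite ler_wpM2l ?powR_ge0// lerD2l normrN.
      by rewrite ge0_ler_powR ?nnegrE ?mulr_ge0 ?(ltW k0) ?(ltW q0).
  rewrite ge0_integralZl//; last 2 first.
  + apply: emeasurable_funD => //.
    by apply: measurable_normpow; exact: measurable_funTS.
  + by move=> x _; rewrite adde_ge0// lee_fin powR_ge0.
  rewrite ge0_integralD//; last 2 first.
  + by apply: measurable_normpow; exact: measurable_funTS.
  + by move=> x _; rewrite lee_fin powR_ge0.
  rewrite integral_cst//.
  apply: (@le_trans _ _ ((2 `^ q)%:E *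
     ((k `^ q)%:E * mu P + ((2 * k) `^ q)%:E * mu P))%E).
    by rewrite lee_pmul2l ?lte_fin ?powR_gt0// leeD2r.
  rewrite -(fineK fmuP) -!EFinM lee_fin.
  rewrite (_ : 8 = 2 * 2 * 2); last by ring.
  rewrite !powRM ?mulr_ge0 ?(ltW k0)//.
  (* With t = 2^q the bound reduces to 1 + t <= t^2, which holds as t >= 2. *)
  have t2 : 2 <= 2 `^ q :> R by apply: le1r_powR; rewrite ?ler1n// ltW.
  set t := 2 `^ q in t2 *; set u := k `^ q; set m := fine (mu P).
  rewrite [leRHS](_ : _ = t * u * m * (t * t)); last by ring.
  rewrite [leLHS](_ : _ = t * u * m * (1 + t)); last by ring.
  rewrite ler_wpM2l//; last by nra.
  by rewrite !mulr_ge0 ?powR_ge0 ?fine_ge0.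
- under eq_Rintegral => x /set_mem Px do rewrite b1//.
  by rewrite RintegralB// ?Rintegral_cst ?avgE ?subrr//; exact: integrable_cell_cst.
Qed.

End finite_cell.

End blocks.

(** * The Calderon-Zygmund decomposition of a block *)

Section calderon_zygmund.
Context {R : realType}.
Local Notation T := (measurableTypeR R * measurableTypeR R)%type.
Variable mu : {measure set T -> \bar R}.
Hypothesis mu_line : forall b s, mu [set x | coord b x = s] = 0%E.
Hypothesis mu_rectangle : forall A, rectangle A -> (mu A < +oo)%E.
Variable q : R.
Hypothesis q1 : 1 < q.

Let q0 : 0 < q. Proof. exact: lt_trans ltr01 q1. Qed.

(* The factor 96 makes each of the three contributions to the total weight of
   the blocks at most [1 / 12]. *)
Definition cz_level : R := 96 `^ (q - 1)^-1.

Lemma cz_level_gt0 : 0 < cz_level.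
Proof. by rewrite powR_gt0. Qed.

Lemma cz_level_ge1 : 1 <= cz_level.
Proof.
rewrite -[leLHS](powRr0 96) ler_powR ?ler1n// invr_ge0 subr_ge0; exact: ltW.
Qed.

(** This is the defining property, that the power q - 1 of the level is 96, multiplied by the level.
    It is the gain in passing from q-th powers to first powers on the critical tiles. *)
Lemma cz_level_powq : cz_level `^ q = 96 * cz_level.
Proof.
rewrite -mulr_powRB1 ?(ltW cz_level_gt0)// mulrC; congr (_ * _).
by rewrite -powRrM mulVf ?powRr1// gt_eqF// subr_gt0.
Qed.

Let le_integral_fine (P : set T) (F : T -> R) (k : R) : measurable P -> (mu P < +oo)%E ->
  mu.-integrable P (EFin \o F) -> \int[mu]_(x in P) F x <= k * fine (mu P) ->
  (\int[mu]_(x in P) (F x)%:E <= k%:E * mu P)%E.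
Proof.
move=> mP muP iF Fk; have fmuP : mu P \is a fin_num by rewrite ge0_fin_numE.
have fI : (\int[mu]_(x in P) (F x)%:E)%E \is a fin_num.
  exact: integrable_fin_num iF.
rewrite -[leLHS](fineK fI).
by rewrite -(fineK fmuP) -EFinM lee_fin.
Qed.

(** The three terms of the bound answer three cases. On a critical tile the measure of [P] equals
    k^(-q) times the integral of |a|^q, and the weight is 8k. On a tile where [s] is constant, the
    weight 8e suffices if the mean of |a - s|^q is at most e^q; otherwise the measure of [P] is less
    than e^(-q) times the integral of |a - s|^q, and 8k is affordable. All terms are nonnegative, so
    one bound covers every tile and can be summed. *)
Lemma cz_cell (P : set T) (k e : R) (a s : T -> R) :
  measurable P -> (mu P < +oo)%E -> 0 < k -> 0 < e ->
  measurable_fun setT a -> measurable_fun setT s ->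
  mu.-integrable P (EFin \o (fun x => `|a x| `^ q)) ->
  mu.-integrable P (EFin \o (fun x => `|a x - s x| `^ q)) ->
  \int[mu]_(x in P) (`|a x| `^ q - k `^ q) = 0 \/
  (\int[mu]_(x in P) (`|a x| `^ q - k `^ q) <= 0 /\
   exists c, forall x, P x -> s x = c) ->
  `|avg mu P a| <= 2 * k /\
  exists w, [/\ 0 < w,
    block mu q P w (fun x => (a x - avg mu P a) * \1_P x) &
    w * fine (mu P) <= 8 * k / k `^ q * \int[mu]_(x in P) (`|a x| `^ q) +
       8 * e * fine (mu P) +
       8 * k / e `^ q * \int[mu]_(x in P) (`|a x - s x| `^ q)].
Proof.
move=> mP muP k0 e0 ma ms iaq isq HP.
have kq0 : 0 < k `^ q by rewrite powR_gt0.
have eq0 : 0 < e `^ q by rewrite powR_gt0.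
have m0 : 0 <= fine (mu P) by rewrite fine_ge0.
have X0 : 0 <= \int[mu]_(x in P) (`|a x| `^ q).
  by apply: Rintegral_ge0 => x _; rewrite powR_ge0.
have Y0 : 0 <= \int[mu]_(x in P) (`|a x - s x| `^ q).
  by apply: Rintegral_ge0 => x _; rewrite powR_ge0.
have HE : \int[mu]_(x in P) (`|a x| `^ q - k `^ q) =
    \int[mu]_(x in P) (`|a x| `^ q) - k `^ q * fine (mu P).
  by rewrite RintegralB ?Rintegral_cst//; exact: integrable_cell_cst.
rewrite HE in HP.
have Xle : \int[mu]_(x in P) (`|a x| `^ q) <= k `^ q * fine (mu P).
  by rewrite -subr_le0; case: HP => [->|[]].
have ak : (\int[mu]_(x in P) (`|a x| `^ q)%:E <= (k `^ q)%:E * mu P)%E.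
  exact: le_integral_fine.
split; first exact: (norm_avg_le q1 mP muP ma k0 ak).
have ak0 : (\int[mu]_(x in P) (`|a x - 0| `^ q)%:E <= (k `^ q)%:E * mu P)%E.
  by under eq_integral do rewrite subr0.
have blk := block_sub_avg q1 mP muP ma k0 ak0.
have k8 : 0 < 8 * k by rewrite mulr_gt0.
have e8 : 0 < 8 * e by rewrite mulr_gt0.
have c1 : 0 <= 8 * k / k `^ q by rewrite divr_ge0// ltW.
have e8m : 0 <= 8 * e * fine (mu P) by rewrite mulr_ge0// ltW.
have c2 : 0 <= 8 * k / e `^ q by rewrite divr_ge0// ltW.
set B := _ + _ + _; have B1 : 8 * k / k `^ q * \int[mu]_(x in P) (`|a x| `^ q) <= B.
  by rewrite /B -addrA lerDl; apply: addr_ge0 => //; exact: mulr_ge0.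
have B2 : 8 * e * fine (mu P) <= B.
  by rewrite /B addrAC lerDr; apply: addr_ge0; exact: mulr_ge0.
have B3 : 8 * k / e `^ q * \int[mu]_(x in P) (`|a x - s x| `^ q) <= B.
  by rewrite /B lerDr; apply: addr_ge0 => //; exact: mulr_ge0.
clearbody B.
case: HP => [/eqP|[_ [c sc]]].
  rewrite subr_eq0 => /eqP XE; exists (8 * k); split; [exact: k8|exact: blk|].
  by apply: le_trans B1; rewrite XE mulrA divfK ?gt_eqF.
have [Yle|Ygt] := leP (\int[mu]_(x in P) (`|a x - s x| `^ q))
                      (e `^ q * fine (mu P)).
  exists (8 * e); split; [exact: e8| |exact: B2].
  apply: (@block_sub_avg _ _ _ q1 _ mP muP _ c); [exact: ma|exact: e0|].
  rewrite (eq_integral (fun x => (`|a x - s x| `^ q)%:E)).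
    exact: le_integral_fine.
  by move=> x /set_mem Px; rewrite sc.
exists (8 * k); split; [exact: k8|exact: blk|].
apply: le_trans B3; rewrite -mulrA ler_pM2l//.
by rewrite mulrC ler_pdivlMr// mulrC; exact: ltW.
Qed.

(** [g] is the mean of [a] on each tile, bounded because the mean of |a|^q never exceeds the q-th
    power of the height; the blocks are the deviations from these means. The final 1/4 is three
    times 1/12. *)
Lemma cz_decomposition (A : set T) (k : R) (a : T -> R) :
  rectangle A -> 0 < k -> 0 < fine (mu A) -> block mu q A k a ->
  exists (g : T -> R) (L : seq (set T)) (w : set T -> R) (b : set T -> T -> R), [/\
    [/\ measurable_fun setT g, forall x, `|g x| <= 2 * (cz_level * k) * \1_A x
      & \int[mu]_(x in A) g x = 0],
    forall P, P \in L -> [/\ rectangle P, 0 < w P & block mu q P (w P) (b P)],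
    forall x, a x = g x + \sum_(P <- L) b P x &
    \sum_(P <- L) w P * fine (mu P) <= k * fine (mu A) / 4].
Proof.
move=> rA k0 m0 [ma sa aqA a0].
have mA := rectangle_measurable rA; have muA := mu_rectangle rA.
have fmuA : mu A \is a fin_num by rewrite ge0_fin_numE.
(* [t] is the height. The choice of [e] gives 8 e mu(A) = k mu(A) / 12. *)
pose t := cz_level * k; pose e := k / 96.
have t0 : 0 < t by rewrite mulr_gt0// cz_level_gt0.
have e0 : 0 < e by rewrite divr_gt0.
have tq0 : 0 < t `^ q by rewrite powR_gt0.
have eq0 : 0 < e `^ q by rewrite powR_gt0.
(* The accuracy of the approximation is such that 8 t / e^q times it equals k mu(A) / 12. *)
have d0 : 0 < k * fine (mu A) / 96 / t * e `^ q.
  by rewrite !(mulr_gt0, divr_gt0) ?invr_gt0.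
have aqoo : (\int[mu]_(x in A) (`|a x| `^ q)%:E < +oo)%E.
  by apply: le_lt_trans aqA _; rewrite -(fineK fmuA) -EFinM ltry.
have [s [ms [cs ads] sd]] := adapted_dense mA muA q0 ma aqoo d0.
have iaq := integrable_normpow ma aqoo.
have ia := integrable_normpow1 q1 mA muA ma aqoo.
have isq : mu.-integrable A (EFin \o (fun x => `|a x - s x| `^ q)).
  apply: (integrable_normpow (measurable_funB ma ms)).
  exact: lt_trans sd (ltry _).
have ih : mu.-integrable A (EFin \o (fun x => `|a x| `^ q - t `^ q)).
  exact: (integrableB mA iaq (integrable_cell_cst mA muA (t `^ q))).
have Xle : \int[mu]_(x in A) (`|a x| `^ q) <= k `^ q * fine (mu A).
  rewrite -lee_fin EFinM (fineK fmuA) /Rintegral fineK//.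
  exact: integrable_fin_num.
have tqE : t `^ q = 96 * cz_level * k `^ q.
  by rewrite powRM ?(ltW cz_level_gt0) ?(ltW k0)// cz_level_powq.
(* The selection starts from a nonpositive integral: the mean of |a|^q over [A] is at most k^q,
   below t^q = 96 [cz_level] k^q. *)
have hA : \int[mu]_(x in A) (`|a x| `^ q - t `^ q) <= 0.
  rewrite RintegralB//; last exact: integrable_cell_cst.
  rewrite Rintegral_cst// subr_le0 (le_trans Xle)// ler_wpM2r ?(ltW m0)//.
  rewrite tqE ler_peMl ?powR_ge0//.
  by have := cz_level_ge1; lra.
have [L tL HL] := @rising_sun_tiling _ mu mu_line cs A _ mA
  (rectangle_bounded rA) ih hA.
have rL := rectangle_tiles tL rA.
have sL := tiles_subset tL.
have mL P (PL : P \in L) := rectangle_measurable (rL P PL).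
have iL f P : P \in L -> mu.-integrable A (EFin \o f) ->
    mu.-integrable P (EFin \o f).
  by move=> PL; apply: integrableS => //; [exact: mL|exact: sL].
have cell P : P \in L -> `|avg mu P a| <= 2 * t /\
    exists w, [/\ 0 < w,
    block mu q P w (fun x => (a x - avg mu P a) * \1_P x) &
    w * fine (mu P) <= 8 * t / t `^ q * \int[mu]_(x in P) (`|a x| `^ q) +
       8 * e * fine (mu P) +
       8 * t / e `^ q * \int[mu]_(x in P) (`|a x - s x| `^ q)].
  move=> PL; apply: cz_cell => //.
  - exact: mL.
  - exact/mu_rectangle/rL.
  - exact: iL.
  - exact: iL.
  (* A tile crossed by no line of [cs] lies in one cell, where [s] is constant; for an empty tile
     any constant will do. *)
  - have [->|[hP uP]] := HL _ PL; [by left|right; split=> //].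
    have [[x0 Px0]|nP] := pselect (exists x, P x).
      by exists (s x0) => x Px; exact: adapted_uncrossed ads uP x x0 Px Px0.
    by exists 0 => x Px; case: nP; exists x.
have /choice[w Hw] : forall P, exists w, P \in L -> [/\ 0 < w,
    block mu q P w (fun x => (a x - avg mu P a) * \1_P x) &
    w * fine (mu P) <= 8 * t / t `^ q * \int[mu]_(x in P) (`|a x| `^ q) +
       8 * e * fine (mu P) +
       8 * t / e `^ q * \int[mu]_(x in P) (`|a x - s x| `^ q)].
  move=> P; have [PL|nPL] := boolP (P \in L); last by exists 0.
  by have [_ [w ?]] := cell P PL; exists w.
have mind (v : R) P : P \in L -> measurable_fun setT (fun x : T => v * \1_P x).
  by move=> PL; apply: measurable_funM => //; apply: measurable_indic; exact: mL.
pose g x := \sum_(P <- L) avg mu P a * \1_P x.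
pose b P x := (a x - avg mu P a) * \1_P x.
have aE x : a x = g x + \sum_(P <- L) b P x.
  rewrite -big_split /=.
  under eq_bigr do rewrite -mulrDl addrC subrK.
  rewrite -mulr_sumr -(tiles_indic x tL) indicE.
  have [xA|] := boolP (x \in A); first by rewrite mulr1.
  by rewrite notin_setE => /sa ->; rewrite mul0r.
exists g, L, w, b; split => //.
- split.
  + by apply: measurable_fun_big_seq => P /mind.
  + move=> x; rewrite (tiles_indic x tL) mulr_sumr.
    rewrite (le_trans (ler_norm_sum _ _ _))// big_seq [leRHS]big_seq.
    apply: ler_sum => P PL; have [avgP _] := cell P PL.
    by rewrite normrM [X in _ * X]ger0_norm ?ler_wpM2r// indicE.
  + have i1 P : P \in L -> mu.-integrable A (EFin \o (\1_P : T -> R)).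
      move=> PL; apply: measurable_bounded_integrable => //.
        by apply: measurable_indic; exact: mL.
      exists 1; split=> // N N1 x _; rewrite /= indicE (le_trans _ (ltW N1))//.
      by rewrite ger0_norm// lern1 leq_b1.
    rewrite Rintegral_sum//; last first.
      move=> P PL; exact: (integrableZl mA (avg mu P a) (i1 P PL)).
    (* Averaging preserves the integral over each tile, so [g] inherits the zero integral of [a]. *)
    rewrite -[RHS]a0 (Rintegral_tiles tL mA ia) big_seq [RHS]big_seq.
    apply: eq_bigr => P PL; rewrite RintegralZl ?i1//.
    rewrite -(avgE (mL P PL) (mu_rectangle (rL P PL)) ma); congr (_ * _).
    rewrite /Rintegral (integral_indic mu mA (mL P PL)) setIidl//.
    exact: sL.
- by move=> P PL; have [? ? _] := Hw P PL; split => //; exact: rL.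
- apply: (@le_trans _ _ (\sum_(P <- L) (8 * t / t `^ q * \int[mu]_(x in P) (`|a x| `^ q) +
       8 * e * fine (mu P) +
       8 * t / e `^ q * \int[mu]_(x in P) (`|a x - s x| `^ q)))).
    by rewrite big_seq [leRHS]big_seq; apply: ler_sum => P /Hw[].
  rewrite !big_split /= -!mulr_sumr.
  rewrite -(Rintegral_tiles tL mA iaq) -(Rintegral_tiles tL mA isq).
  have -> : \sum_(P <- L) fine (mu P) = fine (mu A).
    have := Rintegral_tiles tL mA (integrable_cell_cst mA muA 1).
    rewrite Rintegral_cst// mul1r => ->; rewrite big_seq [RHS]big_seq.
    by apply: eq_bigr => P PL; rewrite Rintegral_cst ?mul1r//; exact: mL.
  have Yle : \int[mu]_(x in A) (`|a x - s x| `^ q) <=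
      k * fine (mu A) / 96 / t * e `^ q.
    rewrite -lee_fin /Rintegral fineK ?(ltW sd)//.
    exact: integrable_fin_num.
  (* The critical contribution: k^q / t^q = 1 / (96 [cz_level]) and t = [cz_level] k, so the level
     cancels and 8/96 remains. *)
  have h1 : 8 * t / t `^ q * \int[mu]_(x in A) (`|a x| `^ q) <=
      k * fine (mu A) / 12.
    rewrite (_ : k * fine (mu A) / 12 = 8 * t / t `^ q * (k `^ q * fine (mu A))).
      by apply: ler_wpM2l Xle; exact: (ltW (divr_gt0 (mulr_gt0 _ t0) tq0)).
    have c0 : cz_level != 0 by rewrite gt_eqF// cz_level_gt0.
    have kq0 : k `^ q != 0 by rewrite gt_eqF// powR_gt0.
    by rewrite tqE /t; field; rewrite c0 kq0.
  have h2 : 8 * e * fine (mu A) = k * fine (mu A) / 12 by rewrite /e; field.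
  have h3 : 8 * t / e `^ q * \int[mu]_(x in A) (`|a x - s x| `^ q) <=
      k * fine (mu A) / 12.
    rewrite (_ : k * fine (mu A) / 12 =
        8 * t / e `^ q * (k * fine (mu A) / 96 / t * e `^ q)).
      by apply: ler_wpM2l Yle; exact: (ltW (divr_gt0 (mulr_gt0 _ t0) eq0)).
    by field; rewrite !gt_eqF.
  by apply: le_trans (lerD (lerD h1 (lexx _)) h3) _; rewrite h2; lra.
Qed.

End calderon_zygmund.

(** * The Bessel measure has null lines and finite mass on rectangles *)

Section bessel_plane.
Context {R : realType}.
Variable lam : R.
Hypothesis lam0 : 0 < lam.

Lemma mlam_set1 (s : R) : mlam lam [set s] = 0%E.
Proof. by rewrite /mlam (@integral_Sset1 _ _ _ s)//; exact: subIsetl. Qed.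

Lemma mulam_line b (s : R) : mulam lam [set x | coord b x = s] = 0%E.
Proof.
case: b => /=; rewrite /mulam.
- rewrite (_ : [set x | _] = [set s] `*` setT); last first.
    by apply/seteqP; split=> -[x y] //=; tauto.
  by rewrite product_measure1E// [X in (X * _)%E]mlam_set1 mul0e.
- rewrite (_ : [set x | _] = setT `*` [set s]); last first.
    by apply/seteqP; split=> -[x y] //=; tauto.
  by rewrite product_measure1E// [X in (_ * X)%E]mlam_set1 mule0.
Qed.

(** On [I], contained in ]0, M + 1], the density is at most (M + 1)^(2 lam), as the exponent is
    nonnegative. *)
Lemma mlam_bounded (I : set R) : is_interval I -> bounded_set I ->
  I `<=` `]0, +oo[ -> (mlam lam I < +oo)%E.
Proof.
move=> iI [M [_ bI]] I0; have mI := is_interval_measurable iI.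
have IM x : I x -> 0 < x <= M + 1.
  move=> Ix; have := I0 x Ix; rewrite /= in_itv /= andbT => x0.
  by rewrite x0 (le_trans (ler_norm _))// bI// ltrDl.
rewrite /mlam setIidl//.
apply: (@le_lt_trans _ _
  (\int[lebesgue_measure]_(x in I) ((M + 1) `^ (2 * lam))%:E)%E).
  apply: ge0_le_integral => //.
  - by move=> x _; rewrite lee_fin powR_ge0.
  - apply/measurable_EFinP; apply: measurable_funTS; exact: measurable_powR.
  - move=> x /IM /andP[x0 xM]; rewrite lee_fin ge0_ler_powR ?nnegrE//.
    + by rewrite mulr_ge0// ltW.
    + exact: ltW.
    + exact: le_trans (ltW x0) xM.
rewrite integral_cst//; apply: lte_mul_pinfty; rewrite ?lee_fin ?powR_ge0//.
apply: (@le_lt_trans _ _ (lebesgue_measure `[0%R : R, M + 1]%classic)).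
  apply: le_measure; rewrite ?inE// => x /IM /andP[x0 xM].
  by rewrite /= in_itv /= xM ltW.
by rewrite lebesgue_measure_itv/=; case: ifPn => // _; rewrite -EFinB ltry.
Qed.

Lemma mulam_rectangle A : rectangle A -> (mulam lam A < +oo)%E.
Proof.
move=> [I [J [[iI bI] I0 [iJ bJ] J0 ->]]].
have -> : mulam lam (I `*` J) = (mlam lam I * mlam lam J)%E.
  by apply: product_measure1E; exact: is_interval_measurable.
have bIoo := mlam_bounded iI bI I0; have bJoo := mlam_bounded iJ bJ J0.
rewrite lte_mul_pinfty// ?ge0_fin_numE//.
Qed.

End bessel_plane.

(** * Complex-valued functions and their L^1 seminorm *)

Section complex_functions.
Context {R : realType}.
Local Notation T := (measurableTypeR R * measurableTypeR R)%type.
Local Notation fct := (R * R -> R[i]).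
Implicit Types (f g : fct) (lam : R).
Import Normc.

Lemma normc_ge0 (z : R[i]) : 0 <= normc z.
Proof. by case: z => x y; exact: sqrtr_ge0. Qed.

Lemma normc_real (x : R) : normc (x%:C)%C = `|x|.
Proof. by rewrite /normc /= expr0n/= addr0 sqrtr_sqr. Qed.

Lemma normc_i : normc 'i%C = 1 :> R.
Proof. by rewrite /normc /= expr0n/= expr1n add0r sqrtr1. Qed.

Lemma normc_Re (z : R[i]) : `|complex.Re z| <= normc z.
Proof.
case: z => x y /=; rewrite -sqrtr_sqr ler_sqrt ?addr_ge0 ?sqr_ge0//.
by rewrite lerDl sqr_ge0.
Qed.

Lemma normc_Im (z : R[i]) : `|complex.Im z| <= normc z.
Proof.
case: z => x y /=; rewrite -sqrtr_sqr ler_sqrt ?addr_ge0 ?sqr_ge0//.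
by rewrite lerDr sqr_ge0.
Qed.

Lemma complex_ReIm (z : R[i]) :
  z = (complex.Re z)%:C%C + 'i%C * (complex.Im z)%:C%C.
Proof.
by case: z => x y; apply/eqP; rewrite eq_complex /= !(mul0r, mul1r, mulr0, subr0, addr0, add0r) !eqxx.
Qed.

Lemma measurableC_real (h : R * R -> R) : measurable_fun [set: R * R] h ->
  Defs.measurableC (fun x => (h x)%:C%C).
Proof. by move=> mh; split => //=; exact: measurable_cst. Qed.

Lemma measurableCD f g : Defs.measurableC f -> Defs.measurableC g ->
  Defs.measurableC (fun x => f x + g x).
Proof.
move=> [mf1 mf2] [mg1 mg2]; split.
  rewrite (_ : (fun _ => _) = fun x => complex.Re (f x) + complex.Re (g x)).
    exact: measurable_funD.
  by apply/funext => x; case: (f x) => ? ?; case: (g x).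
rewrite (_ : (fun _ => _) = fun x => complex.Im (f x) + complex.Im (g x)).
  exact: measurable_funD.
by apply/funext => x; case: (f x) => ? ?; case: (g x).
Qed.

Lemma measurableCZ (c : R[i]) f : Defs.measurableC f -> Defs.measurableC (fun x => c * f x).
Proof.
case: c => u v [mf1 mf2]; split.
  rewrite (_ : (fun _ => _) = fun x => u * complex.Re (f x) - v * complex.Im (f x)).
    by apply: measurable_funB; exact: measurable_funM.
  by apply/funext => x; case: (f x).
rewrite (_ : (fun _ => _) = fun x => u * complex.Im (f x) + v * complex.Re (f x)).
  by apply: measurable_funD; exact: measurable_funM.
by apply/funext => x; case: (f x).
Qed.

Lemma measurableCB f g : Defs.measurableC f -> Defs.measurableC g ->
  Defs.measurableC (fun x => f x - g x).
Proof.
move=> mf /(measurableCZ (-1)) mg.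
by under eq_fun do rewrite -mulN1r; exact: measurableCD.
Qed.

Lemma measurableC_sum (I : eqType) (r : seq I) (F : I -> fct) :
  (forall i, i \in r -> Defs.measurableC (F i)) ->
  Defs.measurableC (fun x => \sum_(i <- r) F i x).
Proof.
elim: r => [|i r IH] mF.
  by under eq_fun do rewrite big_nil; split; exact: measurable_cst.
under eq_fun do rewrite big_cons; apply: measurableCD.
  by apply: mF; rewrite mem_head.
by apply: IH => j jr; apply: mF; rewrite inE jr orbT.
Qed.

Lemma measurable_normc f : Defs.measurableC f ->
  measurable_fun [set: T] (fun x => normc (f x)).
Proof.
move=> [mf1 mf2].
rewrite (_ : (fun _ => _) =
  Num.sqrt \o (fun x => complex.Re (f x) ^+ 2 + complex.Im (f x) ^+ 2)).
  apply: measurableT_comp.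
    by apply: continuous_measurable_fun; exact: sqrt_continuous.
  by apply: measurable_funD; exact: measurable_funX.
by apply/funext => x /=; case: (f x).
Qed.

Section L1norm.
Variable lam : R.
Local Notation N1 f := (LnormC lam 1%E f).

Lemma LnormC1E f : N1 f = (\int[mulam lam]_x (normc (f x))%:E)%E.
Proof.
rewrite /LnormC Lnorm1; apply: eq_integral => x _.
by rewrite gee0_abs// lee_fin normc_ge0.
Qed.

Lemma LnormC1_ge0 f : (0 <= N1 f)%E.
Proof. exact: Lnorm_ge0. Qed.

Lemma LnormC1D f g : Defs.measurableC f -> Defs.measurableC g ->
  (N1 (fun x => f x + g x)%R <= N1 f + N1 g)%E.
Proof.
move=> mf mg; rewrite !LnormC1E -ge0_integralD//; last 4 first.
- by move=> x _; rewrite lee_fin normc_ge0.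
- by apply/measurable_EFinP; exact: measurable_normc.
- by move=> x _; rewrite lee_fin normc_ge0.
- by apply/measurable_EFinP; exact: measurable_normc.
apply: ge0_le_integral => //.
- by move=> x _; rewrite lee_fin normc_ge0.
- by apply/measurable_EFinP; apply: measurable_normc; exact: measurableCD.
- by apply: emeasurable_funD; apply/measurable_EFinP; exact: measurable_normc.
- by move=> x _; rewrite -EFinD lee_fin le_normcD.
Qed.

Lemma LnormC1Z (c : R[i]) f : Defs.measurableC f ->
  N1 (fun x => c * f x) = ((normc c)%:E * N1 f)%E.
Proof.
move=> mf; rewrite !LnormC1E -ge0_integralZl//.
- by apply: eq_integral => x _; rewrite -EFinM normcM.
- by apply/measurable_EFinP; exact: measurable_normc.
- by move=> x _; rewrite lee_fin normc_ge0.
- by rewrite lee_fin normc_ge0.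
Qed.

Lemma LnormC1_sum (I : eqType) (r : seq I) (F : I -> fct) :
  (forall i, i \in r -> Defs.measurableC (F i)) ->
  (N1 (fun x => \sum_(i <- r) F i x)%R <= \sum_(i <- r) N1 (F i))%E.
Proof.
elim: r => [|i r IH] mF.
  rewrite big_nil LnormC1E integral0_eq// => x _.
  by rewrite big_nil normc0.
have mr j : j \in r -> Defs.measurableC (F j).
  by move=> jr; apply: mF; rewrite inE jr orbT.
under [X in (LnormC _ _ X <= _)%E]eq_fun do rewrite big_cons.
rewrite big_cons; apply: le_trans (LnormC1D _ _) _.
- by apply: mF; rewrite mem_head.
- exact: measurableC_sum.
- by rewrite leeD2l// IH.
Qed.

Lemma LnormC1_null f A : Defs.measurableC f -> measurable A -> mulam lam A = 0%E ->
  (forall x, ~ A x -> f x = 0) -> N1 f = 0%E.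
Proof.
move=> mf mA A0 sf; rewrite LnormC1E.
have mE : measurable_fun [set: T] (fun x => (normc (f x))%:E).
  by apply/measurable_EFinP; exact: measurable_normc.
rewrite (ge0_negligible_integral _ _ _ _ A0)//.
  by apply: integral0_eq => x [_ nAx]; rewrite sf// normc0.
by move=> x _; rewrite lee_fin normc_ge0.
Qed.

End L1norm.
End complex_functions.

(** * Atoms versus blocks *)

Section atoms.
Context {R : realType}.
Local Notation T := (measurableTypeR R * measurableTypeR R)%type.
Local Notation fct := (R * R -> R[i]).
Variables lam q : R.
Hypotheses (lam0 : 0 < lam) (q1 : 1 < q).
Local Notation mu := (mulam lam).
Implicit Types (a f : fct) (A P : set (R * R)) (b g : R * R -> R).
Import Normc.

Let q0 : 0 < q. Proof. exact: lt_trans ltr01 q1. Qed.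

Lemma integral_support A (F : T -> \bar R) : (forall x, ~ A x -> F x = 0%E) ->
  (\int[mu]_(x in A) F x = \int[mu]_x F x)%E.
Proof.
move=> sF; rewrite integral_mkcond; apply: eq_integral => x _.
rewrite /patch; case: ifPn => //; rewrite notin_setE => /sF ->//.
Qed.

Lemma Rintegral_support A (F : T -> R) : (forall x, ~ A x -> F x = 0) ->
  \int[mu]_(x in A) F x = \int[mu]_x F x.
Proof. by move=> sF; rewrite /Rintegral integral_support// => x /sF ->. Qed.

Lemma integralC_real (h : T -> R) :
  integralC lam (fun x => (h x)%:C%C) = (\int[mu]_x h x)%:C%C.
Proof. by rewrite /integralC /= Rintegral_cst// mul0r. Qed.

Let fin_rectangle A : rectangle A -> mu A = (fine (mu A))%:E.
Proof.
by move=> /(mulam_rectangle lam0) muA; rewrite fineK// ge0_fin_numE.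
Qed.

Let measurable_normcq f : Defs.measurableC f ->
  measurable_fun setT (fun x => (normc (f x) `^ q)%:E).
Proof.
move=> mf; apply/measurable_EFinP; apply: (measurableT_comp (measurable_powR q)).
exact: measurable_normc.
Qed.

(** Both sides of the size condition are raised to the power q; the new exponent is (1/q - 1) q = 1
    - q. This frees the later estimates from q-th roots. *)
Lemma size_conditionP A a : rectangle A -> 0 < fine (mu A) ->
  (LnormC lam q%:E a <= poweR (mu A) (fine (inve q%:E) - 1))%E <->
  (\int[mu]_x (normc (a x) `^ q)%:E <= (fine (mu A) `^ (1 - q))%:E)%E.
Proof.
move=> rA; rewrite (fin_rectangle rA) /=; set m := fine (mu A) => m0.
rewrite /inve gt_eqF//=.
have qn0 : q != 0 by rewrite gt_eqF.
have -> : LnormC lam q%:E a =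
    ((\int[mu]_x (normc (a x) `^ q)%:E) `^ q^-1)%E.
  rewrite /LnormC unlock; under eq_integral => x _.
    rewrite gee0_abs ?lee_fin ?normc_ge0//; over.
  by [].
have I0 : (0 <= \int[mu]_x (normc (a x) `^ q)%:E)%E.
  by apply: integral_ge0 => x _; rewrite lee_fin powR_ge0.
have mE : (m `^ (1 - q))%:E = (((m `^ (q^-1 - 1))%:E : \bar R) `^ q)%E.
  by rewrite poweR_EFin -powRrM mulrBl mulVf// mul1r.
have mE' : (m `^ (q^-1 - 1))%:E = (((m `^ (1 - q))%:E : \bar R) `^ q^-1)%E.
  by rewrite poweR_EFin -powRrM mulrBl mulfV// mul1r.
set I := (\int[mu]_x _)%E in I0 *.
have IE : I = ((I `^ q^-1) `^ q)%E by rewrite -poweRrM mulVf// poweRe1.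
split=> h.
- rewrite mE IE; apply: gt0_ler_poweR h; rewrite ?(ltW q0)//.
    by rewrite in_itv/= poweR_ge0 leey.
  by rewrite in_itv/= leey lee_fin powR_ge0.
- rewrite mE'; apply: gt0_ler_poweR h; rewrite ?invr_ge0 ?(ltW q0)//.
    by rewrite in_itv/= I0 leey.
  by rewrite in_itv/= leey lee_fin powR_ge0.
Qed.

(** A filler, supported on the empty rectangle: it stands for normalized blocks on null rectangles
    and keeps the lists nonempty that are later concatenated. *)
Lemma zero_atom (p : \bar R) : p != 0%E -> is_atom lam p (cst 0).
Proof.
move=> p0; have s0 : is_interval (set0 : set R) /\ bounded_set (set0 : set R).
  by split => //; exists 0; split => // x _ y.
split; first by split => /=; exact: measurable_cst.
exists set0; split => //.
- by exists set0, set0; split => //; rewrite setX0.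
- rewrite /LnormC (_ : (fun _ => _) = cst 0%E).
    by rewrite Lnorm0// poweR_ge0.
  by apply/funext => x; rewrite /cst normc0.
- by rewrite /integralC /Rintegral /= integral0.
Qed.

Lemma measurableC_atom (p : \bar R) a : is_atom lam p a -> Defs.measurableC a.
Proof. by case. Qed.

Lemma block_atom P (w : R) b : rectangle P -> 0 < w -> block mu q P w b ->
  is_atom lam q%:E (fun x => (b x / (w * fine (mu P)))%:C%C).
Proof.
move=> rP w0 [mb sb bq b0].
have mP := rectangle_measurable rP; have muP := mulam_rectangle lam0 rP.
have [m0|m0] := eqVneq (fine (mu P)) 0.
  (* With zero denominator the quotient is the zero function. *)
  rewrite (_ : (fun _ => _) = cst 0); first by apply: zero_atom; rewrite eqe gt_eqF.
  by apply/funext => x; rewrite m0 mulr0 invr0 mulr0.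
have {}m0 : 0 < fine (mu P) by rewrite lt_neqAle eq_sym m0/= fine_ge0.
have W0 : 0 < w * fine (mu P) by rewrite mulr_gt0.
have mbW : measurable_fun setT (fun x => b x / (w * fine (mu P))).
  exact: measurable_funM.
split; first exact: measurableC_real.
exists P; split => //.
- by move=> x /sb ->; rewrite mul0r.
- apply/size_conditionP => //.
  under eq_integral do rewrite normc_real normrM normfV (gtr0_norm W0)
    powRM ?invr_ge0 ?(ltW W0)// EFinM.
  rewrite ge0_integralZr//; last 2 first.
  + by apply: measurable_normpow.
  + by rewrite lee_fin powR_ge0.
  rewrite -(@integral_support P); last first.
    by move=> x /sb ->; rewrite normr0 powR0// gt_eqF.
  apply: (@le_trans _ _ (((w `^ q)%:E * mu P) * ((w * fine (mu P))^-1 `^ q)%:E)%E).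
    by rewrite lee_wpmul2r// lee_fin powR_ge0.
  rewrite (fin_rectangle rP) -!EFinM lee_fin.
  rewrite -[(w * _)^-1]powR_inv1 ?(ltW W0)// -powRrM mulN1r powRN.
  rewrite powRM ?(ltW w0) ?(ltW m0)// powRB ?(gt_eqF m0) ?implybT//.
  rewrite powRr1 ?(ltW m0)// invfM.
  rewrite [leLHS](_ : _ = (w `^ q / w `^ q) * (fine (mu P) / fine (mu P) `^ q)).
    by rewrite divff ?mul1r// gt_eqF// powR_gt0.
  by ring.
- have ib : mu.-integrable P (EFin \o b).
    apply: (integrable_normpow1 q1) => //.
    by apply: le_lt_trans bq _; rewrite (fin_rectangle rP) -EFinM ltry.
  transitivity (\int[mu]_x (b x / (w * fine (mu P))))%:C%C.
    exact: integralC_real.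
  rewrite -(@Rintegral_support P); last first.
    by move=> x /sb ->; rewrite mul0r.
  by rewrite RintegralZr// b0 mul0r.
Qed.

Lemma bounded_atom A (C : R) g : rectangle A -> 0 < fine (mu A) -> 0 < C ->
  measurable_fun setT g -> (forall x, `|g x| <= C / fine (mu A) * \1_A x) ->
  \int[mu]_(x in A) g x = 0 ->
  is_atom lam +oo%E (fun x => (g x / C)%:C%C).
Proof.
move=> rA m0 C0 mg gC g0; have mA := rectangle_measurable rA.
have muA := mulam_rectangle lam0 rA.
have sg x : ~ A x -> g x = 0.
  move=> nAx; have := gC x; rewrite indicE memNset// mulr0.
  by rewrite normr_le0 => /eqP.
split; first by apply: measurableC_real; exact: measurable_funM.
exists A; split => //.
- by move=> x /sg ->; rewrite mul0r.
(* The L^oo norm is an essential supremum only if the whole space has positive measure, and 0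
   otherwise; hence the two cases. *)
- rewrite /LnormC unlock /inve /= sub0r; case: ifPn => // _; last exact: poweR_ge0.
  apply/ess_supP/nearW => x.
  rewrite (fin_rectangle rA) poweR_EFin powR_inv1 ?(ltW m0)//.
  rewrite [X in (X <= _)%E](_ : _ = `|g x / C|%:E); last first.
    rewrite -[LHS]/(`|(normc (g x / C)%:C%C)%:E|%E).
    by rewrite abse_EFin normc_real normr_id.
  rewrite lee_fin normrM normfV (gtr0_norm C0) ler_pdivrMr//.
  apply: le_trans (gC x) _; rewrite [leRHS]mulrC -[leRHS]mulr1.
  apply: ler_wpM2l; first by rewrite divr_ge0// ltW.
  by rewrite indicE lern1 leq_b1.
- have ig : mu.-integrable A (EFin \o g).
    apply: measurable_bounded_integrable => //; first exact: measurable_funTS.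
    exists (C / fine (mu A)); split; first by rewrite num_real.
    move=> N CN x Ax /=; rewrite (le_trans (gC x))// (le_trans _ (ltW CN))//.
    by rewrite indicE mem_set// mulr1.
  transitivity (\int[mu]_x (g x / C))%:C%C; first exact: integralC_real.
  rewrite -(@Rintegral_support A); last first.
    by move=> x /sg ->; rewrite mul0r.
  by rewrite RintegralZr// g0 mul0r.
Qed.

(** Real and imaginary parts are dominated by |a|, and with m the measure of [A] one has m^(1-q) =
    (1/m)^q m: the level of the blocks is 1/m. Null rectangles are left aside, since an atom on one
    of them is negligible. *)
Lemma atom_blocks a : is_atom lam q%:E a -> exists A, [/\ rectangle A,
  forall x, ~ A x -> a x = 0,
  0 < fine (mu A) ->
    (\int[mu]_x (normc (a x) `^ q)%:E <= (fine (mu A) `^ (1 - q))%:E)%E,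
  0 < fine (mu A) ->
    block mu q A (fine (mu A))^-1 (fun x => complex.Re (a x)) &
  0 < fine (mu A) ->
    block mu q A (fine (mu A))^-1 (fun x => complex.Im (a x))].
Proof.
move=> [ma [A [rA sa Na a0]]]; exists A.
have mA := rectangle_measurable rA.
have aq : 0 < fine (mu A) ->
    (\int[mu]_x (normc (a x) `^ q)%:E <= (fine (mu A) `^ (1 - q))%:E)%E.
  by move=> m0; apply/size_conditionP.
have blk (b : R * R -> R) : 0 < fine (mu A) -> measurable_fun setT b ->
    (forall x, `|b x| <= normc (a x)) -> \int[mu]_x b x = 0 ->
    block mu q A (fine (mu A))^-1 b.
  move=> m0 mb ba b0.
  have sb x : ~ A x -> b x = 0.
    by move=> /sa ax; have := ba x; rewrite ax normc0 normr_le0 => /eqP.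
  split => //; last by rewrite Rintegral_support.
  rewrite integral_support; last first.
    by move=> x /sb ->; rewrite normr0 powR0// gt_eqF.
  apply: (@le_trans _ _ (\int[mu]_x (normc (a x) `^ q)%:E)%E).
    apply: ge0_le_integral => //.
    - exact: measurable_normpow.
    - exact: measurable_normcq.
    - by move=> x _; rewrite lee_fin ge0_ler_powR ?nnegrE ?normc_ge0 ?(ltW q0).
  apply: le_trans (aq m0) _.
  rewrite (fin_rectangle rA) -EFinM lee_fin.
  rewrite -[(fine (mu A))^-1]powR_inv1 ?(ltW m0)// -powRrM mulN1r mulrC.
  by rewrite powRD ?(gt_eqF m0) ?implybT// powRr1 ?(ltW m0).
case: a0 => aRe aIm; split => // m0; apply: blk => //.
- by case: ma.
- by move=> x; exact: normc_Re.
- by case: ma.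
- by move=> x; exact: normc_Im.
Qed.

(** With m the measure of the rectangle, integrating |a| <= 1/m + m^(q-1) |a|^q gives 1 from each
    term. The uniform bound turns small weights into small L^1 norms. *)
Lemma LnormC1_atom a : is_atom lam q%:E a -> (LnormC lam 1%E a <= 2%:E)%E.
Proof.
move=> aa; have ma := measurableC_atom aa.
have [A [rA sa aq _ _]] := atom_blocks aa.
have mA := rectangle_measurable rA.
have [m0|m0] := eqVneq (fine (mu A)) 0.
  by rewrite (LnormC1_null (A := A)) ?lee_fin// fin_rectangle// m0.
have {}m0 : 0 < fine (mu A) by rewrite lt_neqAle eq_sym m0/= fine_ge0.
rewrite LnormC1E -(@integral_support A); last by move=> x /sa ->; rewrite normc0.
set m := fine (mu A) in m0 aq *.
apply: (@le_trans _ _ (\int[mu]_(x in A)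
   ((m^-1)%:E + (m `^ (q - 1))%:E * (normc (a x) `^ q)%:E))%E).
  apply: ge0_le_integral => //.
  - by move=> x _; rewrite lee_fin normc_ge0.
  - by apply: measurable_funTS; apply/measurable_EFinP; exact: measurable_normc.
  - apply: emeasurable_funD => //; apply: measurable_funeM.
    by apply: measurable_funTS; exact: measurable_normcq.
  - move=> x _; rewrite -EFinM -EFinD lee_fin.
    have := @le_add_powR _ q q1 (normc (a x) * m).
    rewrite mulr_ge0 ?normc_ge0 ?(ltW m0)// => /(_ isT).
    rewrite powRM ?normc_ge0 ?(ltW m0)// -ler_pdivlMr// => /le_trans; apply.
    rewrite mulrDl mul1r lerD2l powRB ?(gt_eqF m0) ?implybT//.
    by rewrite powRr1 ?(ltW m0)// le_eqVlt; apply/orP; left; apply/eqP; ring.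
rewrite ge0_integralD//; last 3 first.
- by move=> x _; rewrite lee_fin invr_ge0 ltW.
- by move=> x _; rewrite mule_ge0// lee_fin powR_ge0.
- apply: measurable_funeM; apply: measurable_funTS; exact: measurable_normcq.
rewrite integral_cst// (fin_rectangle rA) -/m -EFinM mulVf ?gt_eqF//.
rewrite (_ : 2 = 1 + 1)// EFinD leeD2l// ge0_integralZl//; last 3 first.
- by apply: measurable_funTS; exact: measurable_normcq.
- by move=> x _; rewrite lee_fin powR_ge0.
- by rewrite lee_fin powR_ge0.
rewrite integral_support; last by move=> x /sa ->; rewrite normc0 powR0// gt_eqF.
apply: (@le_trans _ _ ((m `^ (q - 1))%:E * (m `^ (1 - q))%:E)%E).
  by rewrite lee_wpmul2l ?lee_fin ?powR_ge0//; exact: aq.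
rewrite -EFinM -powRD ?(gt_eqF m0) ?implybT// lee_fin.
by rewrite (_ : q - 1 + (1 - q) = 0) ?powRr0 ?lexx//; ring.
Qed.

(** The easy inclusion: |a| <= 1/m almost everywhere on a set of measure m bounds the integral of
    |a|^q by m^(1-q). *)
Lemma atom_infty_q a : is_atom lam +oo%E a -> is_atom lam q%:E a.
Proof.
move=> [ma [A [rA sa Na a0]]]; split => //; exists A; split => //.
have mA := rectangle_measurable rA.
have [m0|m0] := eqVneq (fine (mu A)) 0.
  have muA0 : mu A = 0%E by rewrite fin_rectangle// m0.
  rewrite /LnormC unlock (_ : (\int[mu]_x _)%E = 0%E).
    by rewrite poweR0r ?invr_neq0 ?gt_eqF ?poweR_ge0.
  have mE : measurable_fun [set: T] (fun x => `|(normc (a x))%:E| `^ q)%E.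
    by under eq_fun do rewrite gee0_abs ?lee_fin ?normc_ge0//;
      exact: measurable_normcq.
  rewrite (ge0_negligible_integral _ _ _ _ muA0)//.
  - apply: integral0_eq => x [_ nAx].
    by rewrite sa// normc0 abse0 poweR0r// gt_eqF.
  - by move=> x _; exact: poweR_ge0.
have {}m0 : 0 < fine (mu A) by rewrite lt_neqAle eq_sym m0/= fine_ge0.
apply/size_conditionP => //.
set m := fine (mu A) in m0 *.
(* If the whole space were null, the L^oo norm would be 0 by convention and carry no information;
   but then the integral vanishes as well. *)
have [muT|muT] := ltP 0%E (mu setT); last first.
  rewrite (_ : (\int[mu]_x _)%E = 0%E) ?lee_fin ?powR_ge0//.
  apply: null_set_integral => //; first exact: measurable_normcq.
  by apply/eqP; rewrite eq_le muT measure_ge0.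
have am : \forall x \ae mu, ((normc (a x))%:E <= (m^-1)%:E)%E.
  move: Na; rewrite /LnormC unlock muT /inve /= sub0r (fin_rectangle rA) /=.
  rewrite -/m powR_inv1 ?(ltW m0)// => /ess_supP.
  under eq_near do rewrite /= ger0_norm ?normc_ge0//.
  by [].
rewrite -(@integral_support A); last first.
  by move=> x /sa ->; rewrite normc0 powR0// gt_eqF.
apply: (@le_trans _ _ (\int[mu]_(x in A) ((m^-1) `^ q)%:E)%E).
  apply: ae_ge0_le_integral => //.
  - by move=> x _; rewrite lee_fin powR_ge0.
  - by apply: measurable_funTS; exact: measurable_normcq.
  - by move=> x _; rewrite lee_fin powR_ge0.
  - case: am => N [mN N0 sN]; exists N; split => // x; apply: contra_notP.
    move=> /(contra_not (@sN x)) /contrapT; rewrite /= !lee_fin => xm _.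
    by rewrite ge0_ler_powR ?nnegrE ?normc_ge0 ?invr_ge0 ?(ltW m0) ?(ltW q0).
rewrite integral_cst// (fin_rectangle rA) -EFinM lee_fin -/m.
rewrite -[m^-1]powR_inv1 ?(ltW m0)// -powRrM mulN1r mulrC.
by rewrite powRD ?(gt_eqF m0) ?implybT// powRr1 ?(ltW m0).
Qed.

End atoms.

#[local] Arguments Normc.normc : simpl never.

(** * Formal finite linear combinations *)

Section combinations.
Context {R : realType}.
Local Notation T := (measurableTypeR R * measurableTypeR R)%type.
Local Notation fct := (R * R -> R[i]).
Implicit Types (L : seq (R[i] * fct)) (F : fct -> seq (R[i] * fct)).
Import Normc.

(** Combinations are lists and not functions because the coefficients must be remembered: [weight]
    depends on the representation and not only on the sum. *)
Definition comb L : fct := fun x => \sum_(p <- L) p.1 * p.2 x.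

Definition weight L : R := \sum_(p <- L) normc p.1.

Definition scale (c : R[i]) L := [seq (c * p.1, p.2) | p <- L].

(** Substitution: each function is replaced by a combination associated with it. One stage of the
    iteration has this form. *)
Definition expand F L := flatten [seq scale p.1 (F p.2) | p <- L].

Lemma weight_ge0 L : 0 <= weight L.
Proof. by apply: sumr_ge0 => p _; exact: normc_ge0. Qed.

Lemma weight_cat L1 L2 : weight (L1 ++ L2) = weight L1 + weight L2.
Proof. by rewrite /weight big_cat. Qed.

Lemma comb_cat L1 L2 x : comb (L1 ++ L2) x = comb L1 x + comb L2 x.
Proof. by rewrite /comb big_cat. Qed.

Lemma weight_scale c L : weight (scale c L) = normc c * weight L.
Proof.
by rewrite /weight big_map mulr_sumr; apply: eq_bigr => p _; rewrite normcM.
Qed.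

Lemma comb_scale c L x : comb (scale c L) x = c * comb L x.
Proof.
by rewrite /comb big_map mulr_sumr; apply: eq_bigr => p _; rewrite mulrA.
Qed.

Lemma mem_scale c L p : p \in scale c L -> exists2 p', p' \in L & p.2 = p'.2.
Proof. by case/mapP => p' p'L ->; exists p'. Qed.

Lemma weight_expand F L :
  weight (expand F L) = \sum_(p <- L) normc p.1 * weight (F p.2).
Proof.
rewrite /expand; elim: L => [|p L IH]; first by rewrite /weight !big_nil.
by rewrite /= weight_cat IH weight_scale big_cons.
Qed.

Lemma comb_expand F L x :
  comb (expand F L) x = \sum_(p <- L) p.1 * comb (F p.2) x.
Proof.
rewrite /expand; elim: L => [|p L IH]; first by rewrite /comb !big_nil.
by rewrite /= comb_cat IH comb_scale big_cons.
Qed.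

Lemma mem_expand F L p : p \in expand F L ->
  exists p1 p2, [/\ p1 \in L, p2 \in F p1.2 & p.2 = p2.2].
Proof.
case/flattenP => s /mapP[p1 p1L ->] /mem_scale[p2 p2F E].
by exists p1, p2.
Qed.

Lemma weight_take n L : weight (take n L) <= weight L.
Proof.
by rewrite -[in leRHS](cat_take_drop n L) weight_cat lerDl weight_ge0.
Qed.

Variable lam : R.
Local Notation N1 f := (LnormC lam 1%E f).

Lemma measurable_comb L : (forall p, p \in L -> Defs.measurableC p.2) ->
  Defs.measurableC (comb L).
Proof. by move=> mL; apply: measurableC_sum => p /mL; exact: measurableCZ. Qed.

Lemma LnormC1_comb (c : R) L : (forall p, p \in L -> Defs.measurableC p.2) ->
  (forall p, p \in L -> (N1 p.2 <= c%:E)%E) ->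
  (N1 (comb L) <= (c * weight L)%:E)%E.
Proof.
move=> mL Lc; apply: le_trans (LnormC1_sum _ _) _.
  by move=> p /mL; exact: measurableCZ.
rewrite /weight mulr_sumr -sumEFin big_seq [leRHS]big_seq.
apply: lee_sum => p pL; rewrite EFinM muleC.
rewrite (LnormC1Z lam p.1 (mL p pL)) muleC [leRHS]muleC.
by rewrite lee_wpmul2r ?lee_fin ?normc_ge0// Lc.
Qed.

End combinations.

(** * One step: an atom as a bounded part plus q-atoms of small weight *)

Section atom_step.
Context {R : realType}.
Local Notation T := (measurableTypeR R * measurableTypeR R)%type.
Local Notation fct := (R * R -> R[i]).
Variables lam q : R.
Hypotheses (lam0 : 0 < lam) (q1 : 1 < q).
Local Notation mu := (mulam lam).
Local Notation N1 f := (LnormC lam 1%E f).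
Import Normc.

(** The decomposition is applied at level 1/m, m being the measure of [A]. The bounded part is then
    at most 2 [cz_level] / m, that is, one oo-atom with coefficient 2 [cz_level], and the weights
    sum to at most (1/m) m / 4. *)
Lemma block_step (A : set (R * R)) (h : R * R -> R) :
  rectangle A -> 0 < fine (mu A) -> block mu q A (fine (mu A))^-1 h ->
  exists G S : seq (R[i] * fct), [/\
    forall p, p \in G -> is_atom lam +oo%E p.2,
    weight G <= 2 * cz_level q,
    forall p, p \in S -> is_atom lam q%:E p.2,
    weight S <= 4^-1 &
    N1 (fun x => (h x)%:C%C - comb G x - comb S x) = 0%E].
Proof.
move=> rA m0 bh; set m := fine (mu A) in m0 bh.
have im0 : 0 < m^-1 by rewrite invr_gt0.
have [g [L [w [b [[mg gle g0] HL hE wle]]]]] :=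
  cz_decomposition (@mulam_line R lam) (@mulam_rectangle R lam lam0) q1
    rA im0 m0 bh.
pose C := 2 * cz_level q.
have C0 : 0 < C by rewrite mulr_gt0// cz_level_gt0.
pose W P := w P * fine (mu P).
have W0 P : P \in L -> 0 <= W P.
  by move=> /HL[_ wP _]; rewrite mulr_ge0 ?fine_ge0 ?(ltW wP).
pose at_ P : fct := fun x => (b P x / W P)%:C%C.
have aat P : P \in L -> is_atom lam q%:E (at_ P).
  by move=> /HL[rP wP bP]; exact: block_atom.
have gat : is_atom lam +oo%E (fun x => (g x / C)%:C%C).
  by apply: (bounded_atom lam0 rA) => // x; rewrite /C -[2 * _ / _]mulrA.
exists [:: (C%:C%C, (fun x => (g x / C)%:C%C) : fct)].
exists [seq (((W P)%:C)%C, at_ P) | P <- L]; split.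
- by move=> p; rewrite inE => /eqP ->.
- by rewrite /weight big_seq1 /= normc_real gtr0_norm.
- by move=> p /mapP[P PL ->]; exact: aat.
- rewrite /weight big_map /= big_seq.
  under eq_bigr => P PL do rewrite normc_real ger0_norm ?W0//.
  by rewrite -big_seq (le_trans wle)// mulVf ?gt_eqF// div1r.
rewrite (_ : (fun x => _) =
    fun x => \sum_(P <- L) ((b P x)%:C%C - (W P)%:C%C * at_ P x)); last first.
  apply/funext => x; rewrite /comb big_seq1 big_map hE /= -rmorphM.
  rewrite mulrCA divff ?gt_eqF// mulr1 sumrB rmorphD /= rmorph_sum /=.
  by rewrite [X in X - _ - _]addrC addrK.
have mb P : P \in L -> Defs.measurableC (fun x => (b P x)%:C%C).
  by move=> /HL[_ _ [mb _ _ _]]; exact: measurableC_real.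
have md P : P \in L ->
    Defs.measurableC (fun x => (b P x)%:C%C - (W P)%:C%C * at_ P x).
  move=> PL; apply: measurableCB; first exact: mb.
  by apply: measurableCZ; case: (aat P PL).
apply/eqP; rewrite eq_le LnormC1_ge0 andbT.
apply: le_trans (LnormC1_sum lam md) _.
rewrite big_seq big1// => P PL; have [rP wP [_ sb _ _]] := HL P PL.
have mP := rectangle_measurable rP.
(* If the weight is 0, the normalized block is the zero function although the block need not be; the
   tile is then null, so the identity holds up to a null set. Otherwise the difference is
   identically zero. *)
have [WP|WP] := eqVneq (W P) 0.
  apply: (LnormC1_null (md P PL) mP) => [|x nPx].
    have := WP; rewrite /W => /eqP; rewrite mulf_eq0 gt_eqF//= => /eqP mP0.
    by rewrite -[LHS]fineK ?ge0_fin_numE ?mP0//; exact: mulam_rectangle.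
  by rewrite /at_ sb// mul0r mulr0 subr0.
apply: (LnormC1_null (md P PL) (@measurable0 _ T)) => [|x _].
  exact: measure0.
by rewrite /at_ -rmorphM /= mulrCA divff// mulr1 subrr.
Qed.

(** The real part plus ['i] times the imaginary part: both weights of [block_step] are doubled. *)
Lemma atom_step (a : fct) : is_atom lam q%:E a ->
  exists G S : seq (R[i] * fct), [/\
    forall p, p \in G -> is_atom lam +oo%E p.2,
    weight G <= 4 * cz_level q,
    forall p, p \in S -> is_atom lam q%:E p.2,
    weight S <= 2^-1 &
    N1 (fun x => a x - comb G x - comb S x) = 0%E].
Proof.
move=> aa; have ma := measurableC_atom aa.
have [A [rA sa _ bRe bIm]] := atom_blocks lam0 q1 aa.
have mA := rectangle_measurable rA.
have [m0|m0] := eqVneq (fine (mu A)) 0.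
  exists [::], [::]; split => //.
  - by rewrite /weight big_nil mulr_ge0// ltW// cz_level_gt0.
  - by rewrite /weight big_nil invr_ge0.
  rewrite (_ : (fun x => _) = a); last first.
    by apply/funext => x; rewrite /comb !big_nil !subr0.
  apply: (LnormC1_null ma mA) => //.
  by rewrite -[LHS]fineK ?ge0_fin_numE ?m0//; exact: mulam_rectangle.
have {}m0 : 0 < fine (mu A) by rewrite lt_neqAle eq_sym m0/= fine_ge0.
have [G1 [S1 [aG1 wG1 aS1 wS1 N11]]] := block_step rA m0 (bRe m0).
have [G2 [S2 [aG2 wG2 aS2 wS2 N12]]] := block_step rA m0 (bIm m0).
exists (G1 ++ scale 'i%C G2), (S1 ++ scale 'i%C S2); split.
- move=> p; rewrite mem_cat => /orP[/aG1//|/mem_scale[p' /aG2 h ->]//].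
- rewrite weight_cat weight_scale normc_i mul1r.
  rewrite (_ : 4 * _ = 2 * cz_level q + 2 * cz_level q); last by ring.
  exact: lerD.
- move=> p; rewrite mem_cat => /orP[/aS1//|/mem_scale[p' /aS2 h ->]//].
- rewrite weight_cat weight_scale normc_i mul1r.
  by rewrite (_ : 2^-1 = 4^-1 + 4^-1); [exact: lerD|field].
have mGS G S (h : R * R -> R) : measurable_fun setT h ->
    (forall p, p \in G -> is_atom lam +oo%E p.2) ->
    (forall p, p \in S -> is_atom lam q%:E p.2) ->
    Defs.measurableC (fun x => (h x)%:C%C - comb G x - comb S x).
  move=> mh aG aS; apply: measurableCB; first apply: measurableCB.
  - exact: measurableC_real.
  - by apply: measurable_comb => p /aG; exact: measurableC_atom.
  - by apply: measurable_comb => p /aS; exact: measurableC_atom.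
have m1 := mGS _ _ _ ma.1 aG1 aS1.
have m2 := mGS _ _ _ ma.2 aG2 aS2.
rewrite (_ : (fun x => _) = fun x =>
   ((complex.Re (a x))%:C%C - comb G1 x - comb S1 x) +
   'i%C * ((complex.Im (a x))%:C%C - comb G2 x - comb S2 x)); last first.
  apply/funext => x; rewrite !comb_cat !comb_scale.
  have := complex_ReIm (a x).
  move: (complex.Re (a x))%:C%C (complex.Im (a x))%:C%C 'i%C => u v i ->.
  by ring.
apply/eqP; rewrite eq_le LnormC1_ge0 andbT.
apply: le_trans (LnormC1D lam m1 (measurableCZ 'i%C m2)) _.
by rewrite N11 LnormC1Z// N12 mule0 adde0.
Qed.

End atom_step.

(** * From a sequence of finite lists to one series *)

Section flattening.
Context {R : realType}.
Local Notation T := (measurableTypeR R * measurableTypeR R)%type.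
Local Notation fct := (R * R -> R[i]).
Implicit Types (L : seq (R[i] * fct)).
Import Normc.

Lemma cvge0P (u : nat -> \bar R) : (forall n, (0 <= u n)%E) ->
  (forall e : R, 0 < e -> \forall n \near \oo, (u n < e%:E)%E) ->
  u n @[n --> \oo] --> 0%E.
Proof.
move=> u0 ue; apply/fine_cvgP; split.
  have := ue 1 ltr01; apply: filterS => n un.
  by rewrite ge0_fin_numE// (lt_trans un)// ltry.
apply/cvgrPdist_lt => e e0; have := ue e e0; apply: filterS => n un.
have fu : u n \is a fin_num by rewrite ge0_fin_numE// (lt_trans un)// ltry.
rewrite sub0r normrN ger0_norm ?fine_ge0//.
by rewrite -lte_fin fineK.
Qed.

Section concatenation.
Variable G : nat -> seq (R[i] * fct).

Fixpoint blocks n := if n is n'.+1 then blocks n' ++ G n' else [::].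

Lemma blocks_prefix m n : (m <= n)%N -> exists L, blocks n = blocks m ++ L.
Proof.
elim: n => [|n IH]; first by rewrite leqn0 => /eqP ->; exists [::].
rewrite leq_eqVlt => /orP[/eqP->|]; first by exists [::]; rewrite cats0.
by rewrite ltnS => /IH[L E]; exists (L ++ G n); rewrite /= E catA.
Qed.

Lemma mem_blocks n p : p \in blocks n -> exists k, p \in G k.
Proof.
elim: n => //= n IH; rewrite mem_cat => /orP[/IH//|pG].
by exists n.
Qed.

Lemma weight_blocks n : weight (blocks n) = \sum_(k < n) weight (G k).
Proof.
elim: n => [|n IH]; first by rewrite /weight big_nil big_ord0.
by rewrite /= weight_cat IH big_ord_recr.
Qed.

Hypothesis G0 : forall n, (0 < size (G n))%N.

Lemma leq_size_blocks n : (n <= size (blocks n))%N.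
Proof.
elim: n => //= n IH; rewrite size_cat -addn1.
exact: leq_add.
Qed.

Let d : R[i] * fct := (0, cst 0).

(** As no list is empty, the first i + 1 lists contain at least i + 1 entries, so index [i] never
    reaches the default value [d]. *)
Definition flat i := nth d (blocks i.+1) i.

Lemma nth_blocks n i : (i < size (blocks n))%N -> nth d (blocks n) i = flat i.
Proof.
move=> ilt; have ilt' : (i < size (blocks i.+1))%N := leq_size_blocks i.+1.
rewrite /flat; have [/blocks_prefix[L E]|/ltnW/blocks_prefix[L E]] := leqP i.+1 n.
  by rewrite E nth_cat ilt'.
by rewrite E nth_cat ilt.
Qed.

Lemma sum_flat (U : nmodType) (F : R[i] * fct -> U) m n :
  (m <= size (blocks n))%N ->
  \sum_(i < m) F (flat i) = \sum_(p <- take m (blocks n)) F p.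
Proof.
move=> mn; rewrite (big_nth d) size_takel// big_mkord.
apply: eq_bigr => i _; rewrite nth_take// nth_blocks//.
exact: leq_trans mn.
Qed.

End concatenation.

(** A partial sum of the flattened series stops inside some list [G n]. It differs from the sum of
    the complete lists before it by an initial segment of [G n], of L^1 norm at most
    [c * weight (G n)]; this tends to 0 because the weights are summable. *)
Lemma atomic_decomposition_blocks (lam : R) (p : \bar R) (f : fct)
    (G : nat -> seq (R[i] * fct)) (c M : R) :
  (forall n, 0 < size (G n))%N ->
  (forall n x, x \in G n -> is_atom lam p x.2) ->
  (forall a, is_atom lam p a -> (LnormC lam 1%E a <= c%:E)%E) -> 0 <= c ->
  Defs.measurableC f ->
  (forall n, \sum_(k < n) weight (G k) <= M) ->
  LnormC lam 1%E (fun x => f x - comb (blocks G n) x) @[n --> \oo] --> 0%E ->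
  exists alpha a, atomic_decomposition lam p f alpha a /\
    (l1sum alpha <= M%:E)%E.
Proof.
move=> G0 aG c1 c0 mf GM cvgf.
pose alpha i := (flat G i).1; pose a i := (flat G i).2.
have aB n x : x \in blocks G n -> is_atom lam p x.2.
  by case/mem_blocks => k /aG.
have partial m : \sum_(i < m) normc (alpha i) <= M.
  have mm := leq_size_blocks G0 m.
  rewrite (sum_flat G0 (fun q => normc q.1) mm).
  by rewrite (le_trans (weight_take _ _))// weight_blocks.
have l1M : (l1sum alpha <= M%:E)%E.
  apply: lime_le; first by apply: is_cvg_nneseries => n _ _; rewrite lee_fin normc_ge0.
  by apply: nearW => n; rewrite big_mkord sumEFin lee_fin.
exists alpha, a; split => //; split.
- move=> i; apply: (aB i.+1); apply: mem_nth; exact: leq_size_blocks.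
- by rewrite (le_lt_trans l1M)// ltry.
have wG0 : weight (G n) @[n --> \oo] --> (0 : R).
  have : cvgn (series (fun n => weight (G n))).
    apply: nondecreasing_is_cvgn.
      by apply/nondecreasing_seqP => n; rewrite seriesSr lerDl weight_ge0.
    by exists M => _ [n _ <-]; rewrite /series /= big_mkord.
  by move/cvg_series_cvg_0.
have small : (LnormC lam 1%E (fun x => (f x - comb (blocks G n) x)%R) +
   (c * weight (G n))%:E)%E @[n --> \oo] --> 0%E.
  rewrite -[0%E]adde0; apply: cvgeD => //.
  apply: cvg_EFin; first exact: nearW.
  by rewrite -(mulr0 c); apply: cvgMr.
apply: cvge0P; first by move=> n; exact: LnormC1_ge0.
move=> e e0; have [n0 _ Hn0] := cvge0_lt small e0.
exists (size (blocks G n0)) => //= m /= nm.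
have ex : exists n, (size (blocks G n) <= m)%N by exists n0.
have ub n : (size (blocks G n) <= m)%N -> (n <= m)%N.
  exact: leq_trans (leq_size_blocks G0 n).
(* [n] is the number of lists that the first [m] terms contain completely. *)
case: (ex_maxnP ex ub) => n nlem nmax.
have n0n : (n0 <= n)%N by exact: nmax.
apply: le_lt_trans (Hn0 n n0n).
have mlt : (m < size (blocks G n.+1))%N.
  by rewrite ltnNge; apply/negP => /nmax; rewrite ltnn.
have sumE x : \sum_(i < m) alpha i * a i x =
    comb (blocks G n) x + comb (take (m - size (blocks G n)) (G n)) x.
  rewrite (sum_flat G0 (fun q : R[i] * fct => q.1 * q.2 x) (ltnW mlt)).
  by rewrite /= take_cat ltnNge nlem /= big_cat.
rewrite (_ : (fun x => _) = fun x => (f x - comb (blocks G n) x) +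
   (-1) * comb (take (m - size (blocks G n)) (G n)) x); last first.
  by apply/funext => x; rewrite sumE opprD addrA mulN1r.
have mc L : (forall x, x \in L -> is_atom lam p x.2) -> Defs.measurableC (comb L).
  by move=> aL; apply: measurable_comb => x /aL[].
have aT x : x \in take (m - size (blocks G n)) (G n) -> is_atom lam p x.2.
  by move=> /mem_take/aG.
have mB := mc _ (@aB n); have mT := mc _ aT.
apply: le_trans (LnormC1D lam (measurableCB mf mB) (measurableCZ (-1) mT)) _.
rewrite leeD2l// LnormC1Z// normcN normc1 mul1e.
apply: le_trans (LnormC1_comb (c := c) _ _) _.
- by move=> x /aT[].
- by move=> x /aT /c1.
- by rewrite lee_fin ler_wpM2l// weight_take.
Qed.

End flattening.

(** * The iteration over all atoms of a series *)

Section iteration.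
Context {R : realType}.
Local Notation fct := (R * R -> R[i]).
Variables lam q : R.
Hypotheses (lam0 : 0 < lam) (q1 : 1 < q).
Local Notation N1 f := (LnormC lam 1%E f).
Import Normc.

(** In the constant, [4 * cz_level q] is the weight of the bounded part per unit of q-atoms, and 2
    is the sum of the geometric series of ratio 1/2 produced by the remainders. *)
Lemma atomic_decomposition_infty (f : fct) (alpha : nat -> R[i]) (a : nat -> fct) :
  Defs.measurableC f -> atomic_decomposition lam q%:E f alpha a ->
  exists beta b, atomic_decomposition lam +oo%E f beta b /\
    (l1sum beta <= (8 * cz_level q)%:E * l1sum alpha)%E.
Proof.
move=> mf [aa sa cvga].
have q0 : 0 < q by exact: lt_trans q1.
have /choice[Gs] : forall x : fct, exists G, exists S : seq (R[i] * fct),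
    is_atom lam q%:E x -> [/\
    forall p, p \in G -> is_atom lam +oo%E p.2,
    weight G <= 4 * cz_level q,
    forall p, p \in S -> is_atom lam q%:E p.2,
    weight S <= 2^-1 &
    N1 (fun y => x y - comb G y - comb S y) = 0%E].
  move=> x; have [ax|nax] := pselect (is_atom lam q%:E x).
    by have [G [S ?]] := atom_step lam0 q1 ax; exists G, S.
  by exists [::], [::].
move=> /choice[Ss step].
(* [S n] is the list of q-atoms that stage [n] treats: what stage [n - 1] left over, and one fresh
   atom of the given series. Thus every stage is finite although the series is infinite. *)
pose S := fix S n := if n is n'.+1 then
  rcons (expand Ss (S n')) (alpha n', a n') else [::].
(* The leading zero entry keeps each list nonempty without changing its weight or its sum. *)
pose G n := (0, cst 0) :: expand Gs (S n) : seq (R[i] * fct).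
have aS n x : x \in S n -> is_atom lam q%:E x.2.
  elim: n x => //= n IH x; rewrite mem_rcons inE => /orP[/eqP->|]; first exact: aa.
  move=> /mem_expand[p1 [p2 [/IH/step[_ _ aS _ _] p2S ->]]].
  exact: aS.
have aG n x : x \in G n -> is_atom lam +oo%E x.2.
  rewrite inE => /orP[/eqP->|]; first exact: zero_atom.
  move=> /mem_expand[p1 [p2 [/aS/step[aG _ _ _ _] p2G ->]]].
  exact: aG.
have wexpand (F : fct -> seq (R[i] * fct)) (k : R) n :
    (forall x, is_atom lam q%:E x -> weight (F x) <= k) ->
    weight (expand F (S n)) <= k * weight (S n).
  move=> Fk; rewrite weight_expand /weight mulr_sumr big_seq [leRHS]big_seq.
  apply: ler_sum => p /aS ap; rewrite mulrC ler_wpM2r ?normc_ge0//.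
  exact: Fk.
have wS n : weight (S n.+1) <= weight (S n) / 2 + normc (alpha n).
  rewrite /= -cats1 weight_cat {2}/weight big_seq1 lerD2r mulrC.
  by apply: wexpand => x /step[].
have wG n : weight (G n) <= 4 * cz_level q * weight (S n).
  rewrite /weight big_cons normc0 add0r -/(weight _).
  by apply: wexpand => x /step[].
(* The extra term [2 * weight (S n)] makes the induction close: by [wS], twice the new weight is at
   most the old weight plus twice the modulus of the new coefficient. *)
have sumS n : \sum_(k < n) weight (S k) + 2 * weight (S n) <=
    2 * \sum_(k < n) normc (alpha k).
  elim: n => [|n IH]; first by rewrite !big_ord0 /weight big_nil mulr0 addr0.
  by rewrite !big_ord_recr /=; have := wS n; rewrite /=; lra.
have sa0 : l1sum alpha \is a fin_num.
  rewrite ge0_fin_numE//; apply: nneseries_ge0 => n _ _.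
  by rewrite lee_fin normc_ge0.
have sal n : \sum_(k < n) normc (alpha k) <= fine (l1sum alpha).
  rewrite -lee_fin fineK// -sumEFin -(big_mkord xpredT (fun i => (normc (alpha i))%:E)).
  by apply: nneseries_lim_ge => i _; rewrite lee_fin normc_ge0.
have sumS' n : \sum_(k < n) weight (S k) <= 2 * fine (l1sum alpha).
  have := sumS n; have := sal n; have := weight_ge0 (S n); lra.
have wS0 : weight (S n) @[n --> \oo] --> (0 : R).
  have : cvgn (series (fun n => weight (S n))).
    apply: nondecreasing_is_cvgn.
      by apply/nondecreasing_seqP => n; rewrite seriesSr lerDl weight_ge0.
    by exists (2 * fine (l1sum alpha)) => _ [n _ <-]; rewrite /series /= big_mkord.
  by move/cvg_series_cvg_0.
have t0 := cz_level_gt0 q.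
have mS n : Defs.measurableC (comb (S n)).
  by apply: measurable_comb => p /aS[].
have mG n : Defs.measurableC (comb (G n)).
  by apply: measurable_comb => p /aG[].
have mB n : Defs.measurableC (comb (blocks G n)).
  by apply: measurable_comb => p /mem_blocks[k /aG[]].
have stepS n : N1 (fun x => comb (S n) x - comb (G n) x -
    comb (expand Ss (S n)) x) = 0%E.
  rewrite (_ : (fun x => _) = fun x => \sum_(p <- S n)
     p.1 * (p.2 x - comb (Gs p.2) x - comb (Ss p.2) x)); last first.
    apply/funext => x; rewrite [comb (G n) x]big_cons mul0r add0r -/(comb _ x).
    rewrite !comb_expand /comb -!sumrB; apply: eq_bigr => p _.
    by rewrite !mulrBr.
  have md p : p \in S n ->
      Defs.measurableC (fun x => p.2 x - comb (Gs p.2) x - comb (Ss p.2) x).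
    move=> /aS ap; have [aGp _ aSp _ _] := step _ ap.
    apply: measurableCB; first apply: measurableCB.
    - by case: ap.
    - by apply: measurable_comb => r /aGp[].
    - by apply: measurable_comb => r /aSp[].
  apply/eqP; rewrite eq_le LnormC1_ge0 andbT.
  apply: le_trans (LnormC1_sum lam _) _.
    by move=> p /md; exact: measurableCZ.
  rewrite big_seq big1// => p pS; rewrite (LnormC1Z lam p.1 (md p pS)).
  by have [_ _ _ _ ->] := step _ (aS _ _ pS); rewrite mule0.
have mA n : Defs.measurableC (fun x => \sum_(i < n) alpha i * a i x).
  elim: n => [|n IH].
    by under eq_fun do rewrite big_ord0; split; exact: measurable_cst.
  under eq_fun do rewrite big_ord_recr; apply: measurableCD => //.
  by apply: measurableCZ; case: (aa n).
(* Invariant, up to null sets: the first [n] terms of the given series equal the oo-atoms produced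
   so far plus the q-atoms still to be treated. *)
have invar n : N1 (fun x => \sum_(i < n) alpha i * a i x -
    comb (blocks G n) x - comb (S n) x) = 0%E.
  elim: n => [|n IH].
    apply/eqP; rewrite eq_le LnormC1_ge0 andbT LnormC1E integral0_eq// => x _.
    by rewrite big_ord0 /comb !big_nil !subr0 normc0.
  rewrite (_ : (fun x => _) = fun x =>
     (\sum_(i < n) alpha i * a i x - comb (blocks G n) x - comb (S n) x) +
     (comb (S n) x - comb (G n) x - comb (expand Ss (S n)) x)); last first.
    apply/funext => x; rewrite big_ord_recr /= -cats1 !comb_cat.
    by rewrite [comb [:: _] x]big_seq1 /=; ring.
  apply/eqP; rewrite eq_le LnormC1_ge0 andbT.
  apply: le_trans (LnormC1D lam _ _) _; last by rewrite IH stepS adde0.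
    by apply: measurableCB => //; exact: measurableCB.
  apply: measurableCB; first exact: measurableCB.
  apply: measurable_comb => x /mem_expand[p1 [p2 [/aS/step[_ _ aSp _ _] p2S ->]]].
  by case: (aSp _ p2S).
have [|||||||beta [b [Hb Hw]]] := @atomic_decomposition_blocks R lam +oo%E f G 2
    (8 * cz_level q * fine (l1sum alpha)).
- by [].
- exact: aG.
- by move=> x /(atom_infty_q lam0 q1); exact: LnormC1_atom.
- by [].
- by [].
- move=> n; apply: (@le_trans _ _ (\sum_(k < n) 4 * cz_level q * weight (S k))).
    by apply: ler_sum => k _; exact: wG.
  rewrite -mulr_sumr; have := sumS' n; nra.
- apply: cvge0P; first by move=> n; exact: LnormC1_ge0.
  have small : (N1 (fun x => (f x - \sum_(i < n) alpha i * a i x)%R) +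
     (2 * weight (S n))%:E)%E @[n --> \oo] --> 0%E.
    rewrite -[0%E]adde0; apply: cvgeD => //.
    apply: cvg_EFin; first exact: nearW.
    by rewrite -(mulr0 2); apply: cvgMr.
  move=> e /(cvge0_lt small); apply: filterS => n; apply: le_lt_trans.
  (* The error is the tail of the given series, a null function by the invariant, and [comb (S n)],
     whose L^1 norm is at most twice a weight that tends to 0. *)
  rewrite (_ : (fun x => _) = fun x => (f x - \sum_(i < n) alpha i * a i x) +
     ((\sum_(i < n) alpha i * a i x - comb (blocks G n) x - comb (S n) x) +
      comb (S n) x)); last first.
    by apply/funext => x; ring.
  have m1 := measurableCB mf (mA n).
  have m2 := measurableCB (measurableCB (mA n) (mB n)) (mS n).
  apply: le_trans (LnormC1D lam m1 (measurableCD m2 (mS n))) _.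
  rewrite leeD2l//; apply: le_trans (LnormC1D lam m2 (mS n)) _.
  rewrite invar add0e; apply: LnormC1_comb => p /aS; first by case.
  exact: LnormC1_atom.
exists beta, b; split => //.
by rewrite -(fineK sa0) -EFinM.
Qed.

End iteration.

(** * Equality of the spaces and comparison of the norms *)

Theorem theorem3p4 (R : realType) (lam q : R) (hlam : 0 < lam) (hq : 1 < q) :
  h1 lam q%:E = h1 lam +oo%E /\
  exists c C : R,
    [/\ 0 < c, 0 < C &
      forall f : R * R -> R[i], h1 lam +oo%E f ->
        (c%:E * h1norm lam +oo%E f <= h1norm lam q%:E f)%E /\
        (h1norm lam q%:E f <= C%:E * h1norm lam +oo%E f)%E].
Proof.
have inftyq f alpha a : atomic_decomposition lam +oo%E f alpha a ->
    atomic_decomposition lam q%:E f alpha a.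
  by move=> [aa sa cvga]; split => // i; exact: atom_infty_q.
split.
  apply/seteqP; split=> f [mf [alpha [a ad]]]; split => //.
    have [beta [b [bd _]]] := atomic_decomposition_infty hlam hq mf ad.
    by exists beta, b.
  by exists alpha, a; exact: inftyq.
have t0 : 0 < 8 * cz_level q by rewrite mulr_gt0// cz_level_gt0.
(* [1] because every oo-atom is a q-atom, so a decomposition serves both spaces; the other constant
   inverts the loss of the iteration. *)
exists (8 * cz_level q)^-1, 1; split => //; first by rewrite invr_gt0.
move=> f [mf _]; split.
  apply: le_ereal_inf_tmp => _ [alpha [a [ad ->]]].
  have [beta [b [bd hb]]] := atomic_decomposition_infty hlam hq mf ad.
  rewrite lee_pdivrMl//; apply: le_trans hb.
  by apply: ereal_inf_lbound; exists beta, b.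
rewrite mul1e; apply: le_ereal_inf_tmp => _ [alpha [a [ad ->]]].
by apply: ereal_inf_lbound; exists alpha, a; split => //; exact: inftyq.
Qed.
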